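(* Let $R(x)=\sum_{i=0}^r u_i x^i\in \mathbb{Z}[x]$ be a nonzero polynomial and let $(x_k)_{k\ge 1}$ be a sequence of real numbers satisfying $\sum_{i=0}^r u_ix_{k+i}=0$ for all $k\ge 1$. Assume $x_k=\sum_{i=1}^n F_i(k)\alpha_i^k$ for all $k\ge 1$, where $\alpha_1,\dots,\alpha_n\in \mathbb{C}$ are pairwise distinct and $F_1,\dots,F_n\in \mathbb{C}[x]$. Assume that at least one of the following conditions holds: (a) there exists $1\le i\le n$ such that $F_i\neq 0$, $\lvert\alpha_i\rvert>1$ and $\alpha_i$ is not an algebraic integer; or (b) there exists $1\le i\le n$ such that $\deg(F_i)\ge 1$, $\lvert\alpha_i\rvert=1$ and $\alpha_i$ is not an algebraic integer; or (c) there exist $1\le i,j\le n$ and a field automorphism $\sigma\colon\mathbb{C}\to\mathbb{C}$ such that $\lvert \alpha_i\rvert>1$, $\lvert\alpha_j\rvert>1$, $\sigma(\alpha_i)=\alpha_j$, and $\sigma(F_i)\neq F_j$; or (d) there exist $1\le i,j\le n$ and a field automorphism $\sigma\colon\mathbb{C}\to\mathbb{C}$ such that $\lvert \alpha_i\rvert\ge 1$, $\lvert\alpha_j\rvert\ge 1$, $\sigma(\alpha_i)=\alpha_j$, and $\deg(\sigma(F_i)- F_j)\ge 1$. Then the set $E$ of limit values of $(\pi(x_{k}))_{k\ge 1}$ is an infinite set, \[\limsup_{k\to \infty} \lVert x_k\rVert \ge 1/L(R),\] and, for every integer $M\ge 1$, there exists an integer $l\ge 0$ such that the set of limit values of $(\pi(x_{kM+l}))_{k\ge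 1}$ is not contained in any interval of $\mathbb{R}/\mathbb{Z}$ of length $<1/\lambda(R)$. Moreover, the assertion that $E$ is an infinite set still holds under the following condition instead of (a)–(d): (e) there exist $1\le i,j\le n$ and a field automorphism $\sigma\colon \mathbb{C}\to \mathbb{C}$ such that $\lvert \alpha_i\rvert> 1$, $\lvert\alpha_j\rvert\ge 1$, $\sigma(\alpha_i)=\alpha_j$, and $\sigma(F_i)\neq F_j$.
   Context: $\pi\colon\mathbb{R}\to\mathbb{R}/\mathbb{Z}$ is the projection; $\lVert x\rVert$ is the distance from $x$ to the nearest integer. $\sigma$ acts on polynomials coefficientwise; $\deg(0)=-1$. For $P(x)=\sum_{i=0}^d a_ix^i\in\mathbb{R}[x]$, its length is $L(P)=\sum_{i=0}^d\lvert a_i\rvert$, and its reduced length is $\ell(P)=\inf_Q L(PQ)$, where $Q$ runs through polynomials in $\mathbb{R}[x]$ with leading coefficient $1$ or constant coefficient $1$. The overreduced length of $R\in\mathbb{Z}[x]$ is $\lambda(R)=\min_Q \ell(R/Q)$, where $Q$ runs through factors of $R$ in $\mathbb{Z}[x]$ such that every root of $Q$ is either a root of unity or has modulus $<1$, and every root of $Q$ that is a root of unity is a simple root of $Q$. *)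

(* Defs.v *)
From HB Require Import structures.
From mathcomp Require Import all_boot all_order all_algebra.
From mathcomp Require Import all_classical all_reals all_analysis.
From mathcomp Require ring_quotient.
From mathcomp Require Import complex.

Set Implicit Arguments.
Unset Strict Implicit.
Unset Printing Implicit Defensive.

Import Order.TTheory GRing.Theory Num.Theory.
Import numFieldNormedType.Exports.

Local Open Scope classical_set_scope.
Local Open Scope ring_scope.

(* [Num.int_num_subdef] is the predicate under the qualifier [Num.int]. *)
Definition int_subgroup (R : realType) : zmodClosed R :=
  GRing.ZmodClosed.clone R (@Num.int_num_subdef R) _.

(* The circle R/Z: the quotient of R by its subgroup [Num.int] of integers,
   with the quotient topology. *)
Notation circle R :=
  (quotient_topology (ring_quotient.Quotient.quot (int_subgroup R))).

Definition circle_proj (R : realType) (x : R) : circle R :=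
  (\pi_(circle R) x)%qT.

Lemma circle_proj_eq (R : realType) (x y : R) :
  circle_proj x = circle_proj y <-> x - y \is a Num.int.
Proof.
have H := ring_quotient.Quotient.idealrBE (int_subgroup R) x y.
split => [E|E].
  by rewrite -[_ \is a _]/(x - y \in int_subgroup R) H; apply/eqP.
by move: E; rewrite -[_ \is a _]/(x - y \in int_subgroup R) H => /eqP.
Qed.

Lemma circle_proj_continuous (R : realType) : continuous (@circle_proj R).
Proof. exact: pi_continuous. Qed.

Definition limit_values (T : topologicalType) (u : nat -> T) : set T :=
  cluster (u @ \oo).

(* An interval of R/Z is the image of an interval [I] of R. A length less
   than [l <= 1] forces [I] to map injectively to R/Z, so that its Lebesgue
   measure is the length of its image. *)
Definition in_short_interval (R : realType) (l : R) (A : set (circle R)) :=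
  exists I : interval R,
    (lebesgue_measure [set` I] < l%:E)%E /\ A `<=` @circle_proj R @` [set` I].

Definition dist_int (R : realType) (x : R) : R :=
  inf [set `|x - m%:~R| | m in [set: int]].

Definition plength (R : realType) (P : {poly R}) : R :=
  \sum_(i < size P) `|P`_i|.

Definition reduced_length (R : realType) (P : {poly R}) : R :=
  inf [set plength (P * Q) | Q in [set Q : {poly R} | Q \is monic \/ Q`_0 = 1]].

Definition int_poly (K : nzRingType) (P : {poly int}) : {poly K} :=
  map_poly intr P.
Arguments int_poly K P : clear implicits.

Definition root_of_unity (K : nzRingType) (z : K) : Prop :=
  exists2 m : nat, (0 < m)%N & z ^+ m = 1.

Definition admissible_factor (R : realType) (Q : {poly int}) : Prop :=
  forall z : R[i], root (int_poly R[i] Q) z ->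
    (root_of_unity z \/ `|z| < 1) /\
    (root_of_unity z -> mup z (int_poly R[i] Q) = 1%N).

(* For P != 0 the cofactor S = P / Q is determined by Q, and P has finitely
   many factors in Z[x], including 1, so the infimum below is a minimum. *)
Definition overreduced_length (R : realType) (P : {poly int}) : R :=
  inf [set reduced_length (int_poly R S) | S in
        [set S | exists2 Q : {poly int}, P = Q * S & admissible_factor R Q]].
Arguments overreduced_length R P : clear implicits.

Definition algebraic_integer (R : realType) (z : R[i]) : Prop :=
  integralOver (intr : int -> R[i]) z.

Section Conditions.
Variables (R : realType) (n : nat).
Variables (alpha : 'I_n -> R[i]) (F : 'I_n -> {poly R[i]}).

Definition cond_a : Prop :=
  exists i : 'I_n,
    [/\ F i != 0, 1 < `|alpha i| & ~ algebraic_integer (alpha i)].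

(* [1 < size P] means deg P >= 1, and [size 0 = 0] matches deg 0 = -1. *)
Definition cond_b : Prop :=
  exists i : 'I_n,
    [/\ (1 < size (F i))%N, `|alpha i| = 1 & ~ algebraic_integer (alpha i)].

Definition cond_c : Prop :=
  exists (i j : 'I_n) (sigma : {rmorphism R[i] -> R[i]}),
    [/\ bijective sigma, 1 < `|alpha i|, 1 < `|alpha j|,
        sigma (alpha i) = alpha j & map_poly sigma (F i) != F j].

Definition cond_d : Prop :=
  exists (i j : 'I_n) (sigma : {rmorphism R[i] -> R[i]}),
    [/\ bijective sigma, 1 <= `|alpha i|, 1 <= `|alpha j|,
        sigma (alpha i) = alpha j
      & (1 < size (map_poly sigma (F i) - F j)%R)%N].

Definition cond_e : Prop :=
  exists (i j : 'I_n) (sigma : {rmorphism R[i] -> R[i]}),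
    [/\ bijective sigma, 1 < `|alpha i|, 1 <= `|alpha j|,
        sigma (alpha i) = alpha j & map_poly sigma (F i) != F j].

End Conditions.

(* Main.v *)
(* An integer sequence [Y] that satisfies a linear recurrence satisfies a monic
   integral one (Fatou), and a field automorphism fixes [Y / N]. Hence, if
   [x - Y / N] is bounded, the characteristic roots of [x] of modulus > 1, and
   those of modulus 1 up to the constant part of their coefficients, are
   inherited from [Y / N]: they are algebraic integers, and conjugate roots
   have conjugate coefficients. This contradicts (a)-(d); if moreover
   [x - Y / N] is asymptotically periodic, the constant parts at roots of
   modulus 1 that are not roots of unity are inherited too, which contradicts
   (e).

   Such a [Y] is found as follows.
   - If limsup ||x_k|| < 1/L(P), the nearest integers to [x_k] eventually
     satisfy the recurrence [P], since [P] applied to them is an integer of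
     absolute value less than 1.
   - If [x_k] mod 1 has finitely many limit values [t_j], then [x_k] is close to
     [Y_k + t_(j k)], which satisfies [P] by discreteness; the relations that
     this imposes on the [t_j] are finitely many rational linear equations,
     hence have a rational solution [tau_j], and [Y_k + tau_(j k)] satisfies
     [P] with bounded denominators.
   - If the limit values along each residue class modulo [M] lie in an interval
     of length < 1/lambda(P), write [P = Q S] with [Q] admissible and choose [T]
     with L(S T) times that length < 1. For the integers [Y] nearest to [x] in
     the given intervals, a window of [v = S Y] and the residue of the index
     determine the next, or the previous, value of [v], so that [v] is
     eventually periodic by pigeonhole. *)
Require Import Defs.
From HB Require Import structures.
From mathcomp Require Import all_boot all_order all_algebra.
From mathcomp Require Import all_classical all_reals all_analysis.
From mathcomp Require Import complex.
From mathcomp Require Import ring lra zify.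

Set Implicit Arguments.
Unset Strict Implicit.
Unset Printing Implicit Defensive.

Import Order.TTheory GRing.Theory Num.Theory.
Import numFieldNormedType.Exports.
Import ComplexField.Normc.

Local Open Scope classical_set_scope.
Local Open Scope ring_scope.

(** * Shift operators *)

(** Polynomials act on sequences with ['X] acting as the shift. By [shiftpM] this is a module
    structure, so recurrences can be handled by divisibility and gcds. *)
Definition shiftp (K : comNzRingType) (D : {poly K}) (u : nat -> K) (k : nat) : K :=
  \sum_(i < size D) D`_i * u (k + i)%N.

(** Annihilation is only eventual, because integer approximations are controlled from some index on.
    The polynomials that kill [u] still form an ideal. *)
Definition kills (K : comNzRingType) (D : {poly K}) (u : nat -> K) : Prop :=
  exists k0, forall k, (k0 <= k)%N -> shiftp D u k = 0.

Section ShiftOperators.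
Variable K : comNzRingType.
Implicit Types (D : {poly K}) (u v : nat -> K).

Lemma shiftp_wide D u m k : (size D <= m)%N ->
  shiftp D u k = \sum_(i < m) D`_i * u (k + i)%N.
Proof.
move=> le_m; rewrite /shiftp (big_ord_widen m (fun i => D`_i * u (k + i)%N)) //.
rewrite big_mkcond /=; apply: eq_bigr => i _; case: ltnP => // le_i.
by rewrite nth_default // mul0r.
Qed.

Lemma shiftpD D1 D2 u k : shiftp (D1 + D2) u k = shiftp D1 u k + shiftp D2 u k.
Proof.
set m := maxn (size D1) (size D2).
rewrite !(@shiftp_wide _ u m) ?leq_maxl ?leq_maxr ?size_polyD // -big_split /=.
by apply: eq_bigr => i _; rewrite coefD mulrDl.
Qed.

Lemma shiftpZ c D u k : shiftp (c *: D) u k = c * shiftp D u k.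
Proof.
rewrite !(@shiftp_wide _ u (size D)) ?size_scale_leq // mulr_sumr.
by apply: eq_bigr => i _; rewrite coefZ mulrA.
Qed.

Lemma shiftp0 u k : shiftp 0 u k = 0.
Proof. by rewrite /shiftp size_poly0 big_ord0. Qed.

Lemma shiftpB D1 D2 u k : shiftp (D1 - D2) u k = shiftp D1 u k - shiftp D2 u k.
Proof. by rewrite -scaleN1r shiftpD shiftpZ mulN1r. Qed.

Lemma shiftpC c u k : shiftp c%:P u k = c * u k.
Proof. by rewrite (@shiftp_wide _ _ 1) ?size_polyC_leq1 // big_ord1 coefC addn0. Qed.

Lemma shiftpMX D u k : shiftp (D * 'X) u k = shiftp D u k.+1.
Proof.
rewrite (@shiftp_wide _ _ (size D).+1); last first.
  by apply: (leq_trans (size_polyMleq _ _)); rewrite size_polyX addn2.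
rewrite big_ord_recl coefMX /= mul0r add0r; apply: eq_bigr => i _.
by rewrite coefMX /= /bump /= add1n addSnnS.
Qed.

Lemma shiftpXn m u k : shiftp 'X^m u k = u (k + m)%N.
Proof.
elim: m k => [|m IH] k; first by rewrite expr0 shiftpC mul1r addn0.
by rewrite exprSr shiftpMX IH addSnnS.
Qed.

Lemma shiftpX u k : shiftp 'X u k = u k.+1.
Proof. by rewrite -(expr1 'X) shiftpXn addn1. Qed.

Lemma shiftp_XsubC c u k : shiftp ('X - c%:P) u k = u k.+1 - c * u k.
Proof. by rewrite shiftpB shiftpX shiftpC. Qed.

Lemma shiftpM D1 D2 u k : shiftp (D1 * D2) u k = shiftp D1 (shiftp D2 u) k.
Proof.
elim/poly_ind: D1 k => [|D1 c IH] k; first by rewrite mul0r !shiftp0.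
by rewrite mulrDl !shiftpD mul_polyC shiftpZ shiftpC -mulrAC !shiftpMX IH.
Qed.

Lemma eq_shiftp D u v k : (forall j, (k <= j)%N -> u j = v j) ->
  shiftp D u k = shiftp D v k.
Proof. by move=> uv; apply: eq_bigr => i _; rewrite uv ?leq_addr. Qed.

Lemma shiftpDr D u v k : shiftp D (fun j => u j + v j) k = shiftp D u k + shiftp D v k.
Proof. by rewrite -big_split; apply: eq_bigr => i _; rewrite mulrDr. Qed.

Lemma shiftpBr D u v k : shiftp D (fun j => u j - v j) k = shiftp D u k - shiftp D v k.
Proof. by rewrite -sumrB; apply: eq_bigr => i _; rewrite mulrBr. Qed.

Lemma shiftpZr D c u k : shiftp D (fun j => c * u j) k = c * shiftp D u k.
Proof. by rewrite /shiftp mulr_sumr; apply: eq_bigr => i _; rewrite mulrCA. Qed.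

Lemma shiftp_eventually0 D u k0 k : (forall j, (k0 <= j)%N -> u j = 0) ->
  (k0 <= k)%N -> shiftp D u k = 0.
Proof.
move=> u0 lek; apply: big1 => i _.
by rewrite u0 ?mulr0 // (leq_trans lek) ?leq_addr.
Qed.

Lemma kills_mull D1 D2 u : kills D2 u -> kills (D1 * D2) u.
Proof.
move=> [k0 h]; exists k0 => k lek; rewrite shiftpM.
exact: shiftp_eventually0 h lek.
Qed.

Lemma kills_mulr D1 D2 u : kills D1 u -> kills (D1 * D2) u.
Proof. by rewrite mulrC; apply: kills_mull. Qed.

Lemma kills_shiftp D1 D2 u : kills (D1 * D2) u <-> kills D1 (shiftp D2 u).
Proof. by split=> -[k0 h]; exists k0 => k lek; rewrite -(h k lek) shiftpM. Qed.

Lemma killsDl D1 D2 u : kills D1 u -> kills D2 u -> kills (D1 + D2) u.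
Proof.
move=> [k1 h1] [k2 h2]; exists (maxn k1 k2) => k; rewrite geq_max => /andP[le1 le2].
by rewrite shiftpD h1 // h2 // addr0.
Qed.

Lemma killsD D u v : kills D u -> kills D v -> kills D (fun k => u k + v k).
Proof.
move=> [k1 h1] [k2 h2]; exists (maxn k1 k2) => k; rewrite geq_max => /andP[le1 le2].
by rewrite shiftpDr h1 // h2 // addr0.
Qed.

Lemma killsB D u v : kills D u -> kills D v -> kills D (fun k => u k - v k).
Proof.
move=> [k1 h1] [k2 h2]; exists (maxn k1 k2) => k; rewrite geq_max => /andP[le1 le2].
by rewrite shiftpBr h1 // h2 // subr0.
Qed.

Lemma killsZ D c u : kills D u -> kills D (fun k => c * u k).
Proof. by move=> [k0 h]; exists k0 => k lek; rewrite shiftpZr h ?mulr0. Qed.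

Lemma kills_eventually D u v k0 : (forall k, (k0 <= k)%N -> u k = v k) ->
  kills D u -> kills D v.
Proof.
move=> uv [k1 h]; exists (maxn k0 k1) => k; rewrite geq_max => /andP[le0 le1].
by rewrite -(h k le1); apply: eq_shiftp => j lej; rewrite uv ?(leq_trans le0).
Qed.

End ShiftOperators.

Lemma shiftp_map (K L : comNzRingType) (f : {rmorphism K -> L}) D u k :
  shiftp (map_poly f D) (f \o u) k = f (shiftp D u k).
Proof.
rewrite (@shiftp_wide _ _ _ (size D)) ?size_poly // /shiftp rmorph_sum.
by apply: eq_bigr => i _; rewrite coef_map rmorphM.
Qed.

Lemma kills_map (K L : comNzRingType) (f : {rmorphism K -> L}) D u :
  kills D u -> kills (map_poly f D) (f \o u).
Proof. by move=> [k0 h]; exists k0 => k lek; rewrite shiftp_map h ?rmorph0. Qed.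

Section KillsField.
Variable K : fieldType.
Implicit Types (D : {poly K}) (u : nat -> K).

Lemma kills_dvdp D1 D2 u : D1 %| D2 -> kills D1 u -> kills D2 u.
Proof. by move=> /dvdpP[q ->]; apply: kills_mull. Qed.

(** By Bezout, the gcd is up to a unit a combination of [D1] and [D2]. *)
Lemma kills_gcdp D1 D2 u : kills D1 u -> kills D2 u -> kills (gcdp D1 D2) u.
Proof.
move=> h1 h2; have [[a b] /= e] := Bezoutp D1 D2.
apply: (@kills_dvdp (a * D1 + b * D2)); first by rewrite (eqp_dvdl _ e).
by apply: killsDl; apply: kills_mull.
Qed.

Lemma coprimep_exp_XsubC (C : {poly K}) b m : C.[b] != 0 ->
  coprimep (('X - b%:P) ^+ m) C.
Proof.
move=> Cb; rewrite coprimep_sym; apply: coprimep_expr.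
by rewrite coprimep_XsubC rootE.
Qed.

End KillsField.

(** * Exponential polynomials *)

Section ExponentialPolynomials.
Variable K : numFieldType.
Implicit Types (D C H : {poly K}) (u v : nat -> K) (b : K).

Lemma coef_comp_polyXD1 H j :
  (H \Po ('X + 1))`_j = \sum_(i < size H) H`_i *+ 'C(i, j).
Proof.
rewrite comp_polyE coef_sum; apply: eq_bigr => i _.
rewrite coefZ exprD1n coef_sum (eq_bigr (fun l : 'I_i.+1 => (l == j :> nat)%:R *+ 'C(i, l))); last first.
  by move=> l _; rewrite coefMn coefXn eq_sym.
case: (ltnP j i.+1) => [lt_j|le_j].
  rewrite (bigD1 (Ordinal lt_j)) //= eqxx big1 ?addr0 ?mulr_natr // => l ne_l.
  by rewrite -val_eqE /= in ne_l; rewrite (negPf ne_l) mul0rn.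
rewrite bin_small // mulr0n big1 ?mulr0 // => l _.
by rewrite ltn_eqF ?mul0rn // (leq_trans (ltn_ord l)).
Qed.

(** The coefficients in degree [deg H] cancel; one degree lower, [deg H] times the leading
    coefficient remains, nonzero in characteristic [0]. *)
Lemma size_forward_difference H : size (H \Po ('X + 1) - H) = (size H).-1.
Proof.
case: (posnP (size H)) => [/eqP|].
  by rewrite size_poly_eq0 => /eqP->; rewrite comp_poly0 subr0 size_poly0.
case E: (size H) => [//|n] _ /=.
have Hn : H`_n != 0.
  by have := lead_coef_eq0 H; rewrite lead_coefE E /= => ->; rewrite -size_poly_eq0 E.
have le_n : (size (H \Po ('X + 1) - H)%R <= n)%N.
  apply/leq_sizeP => j le_j; rewrite coefB coef_comp_polyXD1 E big_ord_recr /=.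
  rewrite big1 ?add0r; last by move=> i _; rewrite bin_small ?mulr0n // (leq_trans _ le_j).
  move: le_j; rewrite leq_eqVlt => /predU1P[<-|lt_j]; first by rewrite binn subrr.
  by rewrite bin_small // mulr0n nth_default ?subrr // E.
case: n => [|n] in E Hn le_n *; first by apply/eqP; rewrite -leqn0.
apply/eqP; rewrite eqn_leq le_n /=; rewrite ltnNge; apply/negP => /leq_sizeP/(_ n (leqnn _)).
rewrite coefB coef_comp_polyXD1 E !big_ord_recr /= big1 ?add0r; last first.
  by move=> i _; rewrite bin_small ?mulr0n.
rewrite binn binSn mulr1n addrAC subrr add0r => /eqP.
by rewrite mulrn_eq0 /= (negPf Hn).
Qed.

Lemma poly_eventually0 H k0 : (forall k, (k0 <= k)%N -> H.[k%:R] = 0) -> H = 0.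
Proof.
move=> H0; apply: (@roots_geq_poly_eq0 _ _ [seq i%:R | i <- iota k0 (size H)]).
- by apply/allP => z /mapP[k + ->]; rewrite mem_iota => /andP[le_k _]; rewrite rootE H0.
- by rewrite map_inj_uniq ?iota_uniq //; move=> i j /eqP; rewrite eqr_nat => /eqP.
- by rewrite size_map size_iota.
Qed.

Lemma shiftp_XsubC_exppoly b H k :
  shiftp ('X - b%:P) (fun k => H.[k%:R] * b ^+ k) k =
  b * ((H \Po ('X + 1) - H).[k%:R] * b ^+ k).
Proof.
have e : ('X + 1 : {poly K}).[k%:R] = k.+1%:R by rewrite !hornerE natr1.
rewrite shiftp_XsubC hornerD hornerN horner_comp e exprS; ring.
Qed.

(** Each factor ['X - b%:P] replaces [H], up to the factor [b], by its forward difference, which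
    lowers a positive size by one. *)
Lemma kills_exppoly b H m : b != 0 ->
  kills (('X - b%:P) ^+ m) (fun k => H.[k%:R] * b ^+ k) <-> (size H <= m)%N.
Proof.
move=> b0; elim: m H => [|m IH] H.
  rewrite leqn0 size_poly_eq0 expr0; split=> [[k0 h]|/eqP->]; last first.
    by exists 0 => k _; rewrite shiftpC horner0 mul0r mulr0.
  apply/eqP/(@poly_eventually0 _ k0) => k /h/eqP.
  by rewrite shiftpC mul1r mulf_eq0 expf_eq0 (negPf b0) andbF orbF => /eqP.
rewrite exprSr; rewrite kills_shiftp.
rewrite (_ : (_ <= m.+1)%N = (size (H \Po ('X + 1) - H)%R <= m)%N); last first.
  by rewrite size_forward_difference -ltnS; case: (size H).
rewrite -IH; split=> h.
  apply: (@kills_eventually _ _ (fun k => b^-1 * shiftp ('X - b%:P) (fun k => H.[k%:R] * b ^+ k) k) _ 0).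
    by move=> k _; rewrite shiftp_XsubC_exppoly mulKf.
  exact: killsZ.
apply: (@kills_eventually _ _ (fun k => b * ((H \Po ('X + 1) - H).[k%:R] * b ^+ k)) _ 0).
  by move=> k _; rewrite shiftp_XsubC_exppoly.
exact: killsZ.
Qed.

(* In the decomposition of a linear recurrence sequence [u] as a sum of
   exponential polynomials, [H] is the coefficient of [b ^+ k]. *)
Definition has_component u b H : Prop :=
  exists2 C : {poly K}, C.[b] != 0 & kills C (fun k => u k - H.[k%:R] * b ^+ k).

(** Both [D * C] and [('X - b%:P) ^+ size H] kill the component, hence so does their gcd, a power of
    ['X - b%:P] up to a unit. By [kills_exppoly] it is the full power, which is prime to [C] and so
    divides [D]. *)
Lemma has_component_dvdp D u b H : b != 0 -> kills D u -> has_component u b H ->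
  ('X - b%:P) ^+ size H %| D.
Proof.
move=> b0 Du [C Cb Cu].
have DCh : kills (D * C) (fun k => H.[k%:R] * b ^+ k).
  apply: (@kills_eventually _ _ (fun k => u k - (u k - H.[k%:R] * b ^+ k)) _ 0).
    by move=> k _; rewrite opprB addrC subrK.
  by apply: killsB; [apply: kills_mulr | apply: kills_mull].
have := kills_gcdp DCh ((kills_exppoly H (size H) b0).2 (leqnn _)).
have /dvdp_exp_XsubCP[m le_m e] := dvdp_gcdr (D * C) (('X - b%:P) ^+ size H).
have := dvdp_gcdl (D * C) (('X - b%:P) ^+ size H).
rewrite (eqp_dvdl _ e) => dvd_m h.
have : kills (('X - b%:P) ^+ m) (fun k => H.[k%:R] * b ^+ k).
  by apply: kills_dvdp h; rewrite (eqp_dvdl _ e).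
rewrite kills_exppoly // => le_s.
have e_m : m = size H by apply/eqP; rewrite eqn_leq le_m le_s.
by move: dvd_m; rewrite e_m Gauss_dvdpl // coprimep_exp_XsubC.
Qed.

Lemma has_componentB u v b H G : has_component u b H -> has_component v b G ->
  has_component (fun k => u k - v k) b (H - G).
Proof.
move=> [C1 C1b h1] [C2 C2b h2]; exists (C1 * C2); first by rewrite hornerM mulf_neq0.
apply: (@kills_eventually _ _ (fun k => (u k - H.[k%:R] * b ^+ k) - (v k - G.[k%:R] * b ^+ k)) _ 0).
  by move=> k _; rewrite hornerD hornerN; ring.
by apply: killsB; [apply: kills_mulr | apply: kills_mull].
Qed.

(** The terms of index [j != i] are killed by a product of powers of the ['X - (alpha j)%:P],
    nonzero at [alpha i] by injectivity. *)
Lemma exppoly_sum_has_component n (alpha : 'I_n -> K) (F : 'I_n -> {poly K}) u i :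
  injective alpha ->
  (forall k, (1 <= k)%N -> u k = \sum_(i < n) (F i).[k%:R] * alpha i ^+ k) ->
  has_component u (alpha i) (F i).
Proof.
move=> inj_alpha uE.
exists (\prod_(j < n | j != i) ('X - (alpha j)%:P) ^+ size (F j)).
  rewrite horner_prod; apply/prodf_neq0 => j ne_j.
  by rewrite horner_exp hornerXsubC expf_neq0 // subr_eq0 (inj_eq inj_alpha) eq_sym.
apply: (@kills_eventually _ _ (fun k => \sum_(j < n | j != i) (F j).[k%:R] * alpha j ^+ k) _ 1).
  by move=> k /uE->; rewrite [X in X - _](bigD1 i) //= addrAC subrr add0r.
set D := \prod_(_ < _ | _) _.
have kj j : j != i -> kills D (fun k => (F j).[k%:R] * alpha j ^+ k).
  move=> ne_j; rewrite /D (bigD1 j) //=; apply: kills_mulr.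
  (* For [alpha j = 0], outside the scope of [kills_exppoly], the term is zero from index [1] on. *)
  have [->|a0] := eqVneq (alpha j) 0; last by rewrite kills_exppoly.
  exists 1%N => k lek; apply: shiftp_eventually0 lek => l.
  by case: l => // l _; rewrite expr0n mulr0.
elim: (index_enum _) => [|j s IH].
  by exists 0 => k _; apply: big1 => l _; rewrite big_nil mulr0.
have [ne_j|eq_j] := boolP (j != i).
  apply: (@kills_eventually _ _ (fun k => (F j).[k%:R] * alpha j ^+ k + \sum_(j <- s | j != i) (F j).[k%:R] * alpha j ^+ k) _ 0).
    by move=> k _; rewrite big_cons ne_j.
  by apply: killsD IH; apply: kj.
by apply: (kills_eventually (k0 := 0)) IH => k _; rewrite big_cons (negPf eq_j).
Qed.

End ExponentialPolynomials.

(** Only algebra is involved, so even discontinuous automorphisms transport components. *)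
Lemma has_component_map (K : numFieldType) (f : {rmorphism K -> K}) u b (H : {poly K}) :
  has_component u b H -> has_component (f \o u) (f b) (map_poly f H).
Proof.
move=> [C Cb h]; exists (map_poly f C); first by rewrite horner_map fmorph_eq0.
apply: (@kills_eventually _ _ (f \o (fun k => u k - H.[k%:R] * b ^+ k)) _ 0).
  by move=> k _ /=; rewrite rmorphB rmorphM rmorphXn -horner_map rmorph_nat.
exact: kills_map.
Qed.

(** * Asymptotics of recurrent sequences *)


Section Asymptotics.
Variable R : realType.
Implicit Types (u v w z : nat -> R[i]) (b : R[i]) (A C D : {poly R[i]}).

(** Moduli are measured by the real number [normc], since the norm of [R[i]] takes its values in
    [R[i]]. *)
Definition ev_bounded u : Prop :=
  exists B : R, exists k0, forall k, (k0 <= k)%N -> normc (u k) <= B.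

Definition vanishing u : Prop :=
  forall e : R, 0 < e -> exists k0, forall k, (k0 <= k)%N -> normc (u k) < e.

Definition ev_periodic (T : Type) (p : nat -> T) (m : nat) : Prop :=
  exists k0, forall k, (k0 <= k)%N -> p (k + m)%N = p k.

Lemma normc_normE (c : R[i]) : `|c| = (normc c)%:C%C.
Proof. by []. Qed.

Lemma normc_gt1 b : (1 < `|b|) = (1 < normc b).
Proof. by rewrite normc_normE -(ltcR 1). Qed.

Lemma normc_ge1 b : (1 <= `|b|) = (1 <= normc b).
Proof. by rewrite normc_normE -(lecR 1). Qed.

Lemma normc_lt1 b : (`|b| < 1) = (normc b < 1).
Proof. by rewrite normc_normE -(ltcR _ 1). Qed.

Lemma normc_eq1 b : `|b| = 1 <-> normc b = 1.
Proof. by rewrite normc_normE; split=> [/complexI|->]. Qed.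

Lemma normc_ge0 b : 0 <= normc b.
Proof. by rewrite -ler0c -normc_normE. Qed.

Lemma normcX b m : normc (b ^+ m) = normc b ^+ m.
Proof. by elim: m => [|m IH]; rewrite ?expr0 ?normc1 // !exprS normcM IH. Qed.

Lemma normc_real (x : R) : normc x%:C%C = `|x|.
Proof. by rewrite /= expr0n /= addr0 sqrtr_sqr. Qed.

Lemma normc_natr m : normc (m%:R : R[i]) = m%:R.
Proof. by rewrite -(rmorph_nat (real_complex R)) normc_real ger0_norm. Qed.

Lemma vanishingD u v : vanishing u -> vanishing v -> vanishing (fun k => u k + v k).
Proof.
move=> hu hv e e0; have e2 : 0 < e / 2 by lra.
have [[k1 h1] [k2 h2]] := (hu _ e2, hv _ e2).
exists (maxn k1 k2) => k; rewrite geq_max => /andP[/h1 ? /h2 ?].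
by apply: le_lt_trans (le_normcD _ _) _; lra.
Qed.

Lemma vanishingZ c u : vanishing u -> vanishing (fun k => c * u k).
Proof.
move=> hu e e0; have c1 : 0 < normc c + 1 by have := normc_ge0 c; lra.
have [k1 h1] := hu _ (divr_gt0 e0 c1).
exists k1 => k /h1; rewrite ltr_pdivlMr // normcM => h.
have := normc_ge0 (u k); nra.
Qed.

Lemma vanishing_shift u m : vanishing u -> vanishing (fun k => u (k + m)%N).
Proof.
move=> hu e /hu[k0 h]; exists k0 => k lek.
by apply: h; rewrite (leq_trans lek) ?leq_addr.
Qed.

Lemma vanishing_eventually u v k0 : (forall k, (k0 <= k)%N -> u k = v k) ->
  vanishing u -> vanishing v.
Proof.
move=> uv hu e /hu[k1 h]; exists (maxn k0 k1) => k.
by rewrite geq_max => /andP[le0 le1]; rewrite -uv // h.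
Qed.

Lemma vanishing_shiftp D u : vanishing u -> vanishing (shiftp D u).
Proof.
move=> hu; elim/poly_ind: D => [|D c IH].
  by move=> e e0; exists 0 => k _; rewrite shiftp0 normc0.
apply: (@vanishing_eventually (fun k => shiftp D u (k + 1)%N + c * u k) _ 0).
  by move=> k _; rewrite shiftpD shiftpMX shiftpC addn1.
by apply: vanishingD; [apply: (vanishing_shift 1) | apply: vanishingZ].
Qed.

Lemma ev_bounded_shiftp D u : ev_bounded u -> ev_bounded (shiftp D u).
Proof.
move=> [B [k0 h]]; elim/poly_ind: D => [|D c [B' [k1 h']]].
  by exists 0; exists 0 => k _; rewrite shiftp0 normc0.
exists (B' + normc c * B); exists (maxn k0 k1) => k; rewrite geq_max => /andP[le0 le1].
rewrite shiftpD shiftpMX shiftpC; apply: le_trans (le_normcD _ _) _.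
rewrite normcM lerD ?h' ?(leqW le1) //.
by apply: ler_wpM2l (h _ le0); apply: normc_ge0.
Qed.

Lemma bernoulli (r : R) k : 1 <= r -> 1 + k%:R * (r - 1) <= r ^+ k.
Proof.
move=> r1; elim: k => [|k IH]; first by rewrite mul0r addr0 expr0.
rewrite exprS -natr1.
have := ler0n R k; have := exprn_ege1 k r1; nra.
Qed.

Lemma natr_unbounded (B c : R) : (forall k : nat, k%:R * c <= B) -> c <= 0.
Proof.
move=> h; rewrite leNgt; apply/negP => c0.
have := h (Num.bound `|B / c|); apply/negP; rewrite -ltNge -ltr_pdivrMr //.
by apply: le_lt_trans (ler_norm _) _; exact: archi_boundP.
Qed.

Lemma shiftp_XsubC0 b w k0 : (forall k, (k0 <= k)%N -> shiftp ('X - b%:P) w k = 0) ->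
  forall k j, (k0 <= k)%N -> w (k + j)%N = b ^+ j * w k.
Proof.
move=> h k j lek; elim: j => [|j IH]; first by rewrite addn0 expr0 mul1r.
have := h (k + j)%N (leq_trans lek (leq_addr _ _)).
by rewrite shiftp_XsubC => /eqP; rewrite subr_eq0 addnS => /eqP->; rewrite IH mulrA exprS.
Qed.

Lemma normc_le0 (c : R[i]) : normc c <= 0 -> c = 0.
Proof. by move=> h; apply: eq0_normc; apply/eqP; rewrite eq_le h normc_ge0. Qed.

(** Eventually [w] is geometric of ratio [b], hence unbounded by Bernoulli's inequality unless it is
    zero. The exponents [1] and [0] fit the reduction step of [mult_at_most_stable]. *)
Lemma ev_bounded_kills_gt1 b w : 1 < normc b -> ev_bounded w ->
  kills (('X - b%:P) ^+ 1) w -> kills (('X - b%:P) ^+ 0) w.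
Proof.
move=> b1 [B [k0 hB]] [k1 h]; exists (maxn k0 k1) => k; rewrite geq_max => /andP[le0 le1].
rewrite expr0 shiftpC mul1r; apply: normc_le0.
have wk := normc_ge0 (w k).
suff: (normc b - 1) * normc (w k) <= 0 by nra.
apply: (@natr_unbounded B) => j.
have := hB _ (leq_trans le0 (leq_addr j k)).
rewrite (shiftp_XsubC0 h) // normcM normcX.
have := bernoulli j (ltW b1); nra.
Qed.

(** The sequence [d] below is geometric of constant modulus, and [w] would grow linearly with slope
    [normc (d k)]. *)
Lemma ev_bounded_kills_eq1 b w : normc b = 1 -> ev_bounded w ->
  kills (('X - b%:P) ^+ 2) w -> kills (('X - b%:P) ^+ 1) w.
Proof.
move=> b1 [B [k0 hB]] [k1 h]; exists (maxn k0 k1) => k; rewrite geq_max => /andP[le0 le1].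
rewrite expr1; apply: normc_le0.
set d := shiftp ('X - b%:P) w.
have h' j : (k1 <= j)%N -> shiftp ('X - b%:P) d j = 0 by move=> /h; rewrite expr2 shiftpM.
apply: (@natr_unbounded (B + normc (w k))) => j.
(* The closed form of [w] is multiplied by [b] to avoid the exponent [j - 1]. *)
have e : b * w (k + j)%N = b ^+ j * (b * w k + j%:R * d k).
  elim: j => [|j IH]; first by rewrite addn0 mul0r addr0 expr0 mul1r.
  have : d (k + j)%N = b ^+ j * d k by apply: (shiftp_XsubC0 h').
  rewrite {1}/d shiftp_XsubC => /eqP; rewrite subr_eq addnS => /eqP->.
  by rewrite mulrDr IH exprS -natr1; ring.
have := congr1 (@normc R) e; rewrite !normcM normcX b1 expr1n !mul1r => e'.
have -> : j%:R * normc (d k) = normc (j%:R * d k) by rewrite normcM normc_natr.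
rewrite (_ : j%:R * d k = (b * w k + j%:R * d k) + - (b * w k)); last by ring.
apply: le_trans (le_normcD _ _) _; rewrite normcN normcM b1 mul1r -e' lerD //.
by apply: hB; rewrite (leq_trans le0) ?leq_addr.
Qed.

(** Eventually [w] is geometric with nondecreasing modulus, so it tends to [0] only if it is
    zero. *)
Lemma vanishing_kills_ge1 b w : 1 <= normc b -> vanishing w ->
  kills (('X - b%:P) ^+ 1) w -> kills (('X - b%:P) ^+ 0) w.
Proof.
move=> b1 hw [k1 h]; exists k1 => k lek; rewrite expr0 shiftpC mul1r.
apply: normc_le0; rewrite leNgt; apply/negP => /[dup] wk /hw[k2 h2].
have := h2 (k + k2)%N (leq_addl _ _); rewrite (shiftp_XsubC0 h) // normcM normcX.
have := exprn_ege1 k2 b1; nra.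
Qed.

(* [b] has multiplicity at most [e] as a characteristic root of [z]. *)
Definition mult_at_most z b e : Prop :=
  exists2 C, C.[b] != 0 & kills (('X - b%:P) ^+ e * C) z.

(** Write [A] as [('X - b%:P) ^+ m] times a factor [C] with [C.[b] != 0]. If [m > e], the hypothesis
    [Sred], applied to images of [z] under recurrences, which stay in [S], lowers [m] to [e] one
    step at a time. *)
Lemma mult_at_most_stable (S : (nat -> R[i]) -> Prop) b e A z :
  (forall D w, S w -> S (shiftp D w)) ->
  (forall w, S w -> kills (('X - b%:P) ^+ e.+1) w -> kills (('X - b%:P) ^+ e) w) ->
  A != 0 -> kills A z -> S z -> mult_at_most z b e.
Proof.
move=> Sstable Sred A0 Az Sz.
have [m [C]] := multiplicity_XsubC A b; rewrite A0 /= rootE => Cb AE.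
exists C => //; move: Az; rewrite {}AE mulrC.
have [le_m|/ltnW le_e] := leqP m e.
  by rewrite -(subnK le_m) exprD -mulrA; apply: kills_mull.
rewrite -(subnK le_e); elim: (m - e)%N => [//|j IH h]; apply: IH.
rewrite exprD mulrAC mulrC kills_shiftp; apply: Sred; first exact: Sstable.
by move: h; rewrite -kills_shiftp mulrCA mulrA -exprD addnS.
Qed.

Lemma ev_bounded_mult_at_most z b e A : A != 0 -> kills A z -> ev_bounded z ->
  1 < normc b \/ normc b = 1 /\ (0 < e)%N -> mult_at_most z b e.
Proof.
move=> A0 Az bz [b1|[b1 e0]].
  have [C Cb h] : mult_at_most z b 0.
    apply: (@mult_at_most_stable ev_bounded b 0 A) => // [D w|w].
    - exact: ev_bounded_shiftp.
    - exact: ev_bounded_kills_gt1.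
  by exists C => //; apply: kills_mull; rewrite expr0 mul1r in h.
have [C Cb h] : mult_at_most z b 1.
  apply: (@mult_at_most_stable ev_bounded b 1 A) => // [D w|w].
  - exact: ev_bounded_shiftp.
  - exact: ev_bounded_kills_eq1.
by exists C => //; rewrite -(subnK e0) exprD -mulrA; apply: kills_mull.
Qed.

(** Applying ['X^m - 1] removes the periodic part and leaves a vanishing sequence, for which [b] has
    multiplicity [0]. As [b ^+ m != 1], this operator can be absorbed into the cofactor. *)
Lemma asymp_periodic_mult_at_most z p m b A : A != 0 -> kills A z ->
  ev_periodic p m -> vanishing (fun k => z k - p k) ->
  1 <= normc b -> b ^+ m != 1 -> mult_at_most z b 0.
Proof.
move=> A0 Az [k0 pm] hz b1 bm.
have [C Cb h] : mult_at_most (shiftp ('X^m - 1) z) b 0.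
  apply: (@mult_at_most_stable vanishing b 0 A) => //.
  - by move=> D w; apply: vanishing_shiftp.
  - by move=> w; apply: vanishing_kills_ge1.
  - by rewrite -kills_shiftp; apply: kills_mulr.
  - apply: (@vanishing_eventually (shiftp ('X^m - 1) (fun k => z k - p k)) _ k0).
      move=> k lek; rewrite !shiftpB !shiftpXn !(@shiftpC _ 1) !mul1r pm //; ring.
    exact: vanishing_shiftp.
exists (C * ('X^m - 1)).
  by rewrite hornerM mulf_neq0 // hornerD hornerN hornerXn hornerC subr_eq0.
by rewrite mulrA kills_shiftp.
Qed.

Lemma contraction_vanishing r (a : nat -> R) : 0 <= r -> r < 1 ->
  (forall k, 0 <= a k) ->
  (forall e, 0 < e -> exists k0, forall k, (k0 <= k)%N -> a k.+1 <= r * a k + e) ->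
  forall e, 0 < e -> exists k0, forall k, (k0 <= k)%N -> a k < e.
Proof.
move=> r0 r1 a0 h e e0.
(* The error [e / 2 * (1 - r)] makes [e / 2] the fixed point of the affine contraction that bounds
   [a]. *)
have [k0 hk] : exists k0, forall k, (k0 <= k)%N -> a k.+1 <= r * a k + e / 2 * (1 - r).
  by apply: h; apply: mulr_gt0; lra.
have ha j : a (k0 + j)%N <= r ^+ j * a k0 + e / 2.
  elim: j => [|j IH]; first by rewrite addn0 expr0 mul1r; lra.
  rewrite addnS exprS; apply: (le_trans (hk _ (leq_addr _ _))); nra.
have [j0 hj] : exists j0, forall j, (j0 <= j)%N -> r ^+ j * a k0 < e / 2.
  have cv : (fun j => r ^+ j * a k0) @ \oo --> (0 : R).
    rewrite -(mul0r (a k0)); apply: cvgMl; apply: cvg_expr; by rewrite ger0_norm.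
  move/cvgrPdist_lt: cv => /(_ (e / 2)) [|j0 _ hj]; first by lra.
  exists j0 => j /hj /=; rewrite sub0r normrN ger0_norm //.
  by apply: mulr_ge0 => //; apply: exprn_ge0.
exists (k0 + j0)%N => k lek; rewrite -(subnKC (leq_trans (leq_addr _ _) lek)).
apply: le_lt_trans (ha _) _.
have := hj (k - k0)%N; rewrite leq_subRL ?(leq_trans (leq_addr _ _) lek) // => /(_ lek); lra.
Qed.

(** Linear factors are removed one at a time: each leaves a contraction of ratio [normc c] with a
    vanishing error. *)
Lemma kills_lt1_vanishing (s : seq R[i]) u : all (fun c => normc c < 1) s ->
  kills (\prod_(c <- s) ('X - c%:P)) u -> vanishing u.
Proof.
elim: s u => [|c s IH] u /=.
  rewrite big_nil => _ [k0 h] e e0; exists k0 => k /h.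
  by rewrite -[1]/(1%:P) shiftpC mul1r => ->; rewrite normc0.
move=> /andP[c1 s1]; rewrite big_cons mulrC kills_shiftp => /(IH _ s1) hv.
apply: (@contraction_vanishing (normc c)) => //; try by move=> *; apply: normc_ge0.
move=> e /hv[k0 h]; exists k0 => k /h; rewrite shiftp_XsubC => /ltW h'.
rewrite (_ : u k.+1 = c * u k + (u k.+1 - c * u k)); last by ring.
by apply: le_trans (le_normcD _ _) _; rewrite normcM lerD2l.
Qed.

Lemma common_order (K : nzRingType) (s : seq K) :
  (forall c, c \in s -> Defs.root_of_unity c) ->
  exists2 m, (0 < m)%N & forall c, c \in s -> c ^+ m = 1.
Proof.
elim: s => [|c s IH] h; first by exists 1%N.
have [|m m0 hm] := IH; first by move=> d ds; apply: h; rewrite inE ds orbT.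
have [l l0 hl] := h c (mem_head _ _).
exists (l * m)%N => [|d]; first by rewrite muln_gt0 l0.
by rewrite inE => /predU1P[->|/hm]; [rewrite exprM hl expr1n | rewrite mulnC exprM => ->; rewrite expr1n].
Qed.

Lemma root_of_unity_normc (c : R[i]) : Defs.root_of_unity c -> normc c = 1.
Proof.
move=> [m m0 cm]; have := congr1 (@normc R) cm; rewrite normcX normc1 => /eqP.
by rewrite pexpr_eq1 ?normc_ge0 // => /eqP.
Qed.

Lemma mup_prod_XsubC (s : seq R[i]) c : mup c (\prod_(d <- s) ('X - d%:P)) = count_mem c s.
Proof.
elim: s => [|d s IH]; first by rewrite big_nil mupNroot // root1.
rewrite big_cons mupM ?IH ?monic_neq0 ?monicXsubC ?monic_prod_XsubC //=.
by rewrite -(expr1 ('X - d%:P)) mup_XsubCX; case: (d == c).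
Qed.

(** The roots of [Q] of modulus less than [1] contribute the vanishing part. The others are simple
    roots of unity, so their linear factors have a product dividing some ['X^m - 1]. A Bezout
    relation splits [w] accordingly. *)
Lemma admissible_asymp_periodic (Q : {poly int}) w : Q != 0 ->
  admissible_factor R Q -> kills (int_poly R[i] Q) w ->
  exists2 m, (0 < m)%N & exists2 p, ev_periodic p m & vanishing (fun k => w k - p k).
Proof.
move=> Q0 admQ Qw.
have QC0 : int_poly R[i] Q != 0.
  by rewrite map_poly_eq0_id0 // intr_eq0 lead_coef_eq0.
have [s QE] := closed_field_poly_normal (int_poly R[i] Q).
have lc0 : lead_coef (int_poly R[i] Q) != 0 by rewrite lead_coef_eq0.
have rs c : c \in s -> root (int_poly R[i] Q) c.
  by move=> cs; rewrite QE rootZ // root_prod_XsubC.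
pose s1 := [seq c <- s | normc c < 1]; pose s2 := [seq c <- s | ~~ (normc c < 1)].
have rs2 c : c \in s2 -> Defs.root_of_unity c.
  rewrite mem_filter => /andP[c1 /rs/admQ[[//|]]].
  by rewrite normc_lt1 (negPf c1).
have [m m0 hm] := common_order rs2.
exists m => //; pose Q1 := \prod_(c <- s1) ('X - c%:P).
have dvdQ2 : \prod_(c <- s2) ('X - c%:P) %| 'X^m - 1.
  apply: uniq_roots_dvdp.
    by apply/allP => c /hm cm; rewrite rootE hornerD hornerN hornerXn hornerC cm subrr.
  rewrite uniq_rootsE; apply: count_mem_uniq => c.
  have [cs2|/count_memPn->//] := boolP (c \in s2).
  have /andP[c1 cs] : ~~ (normc c < 1) && (c \in s) by move: cs2; rewrite mem_filter.
  have [_ /(_ (rs2 _ cs2))] := admQ c (rs c cs).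
  (* The multiplicity of [c] in [Q], equal to [1] by admissibility, is its number of occurrences in
     [s], hence in [s2]. *)
  rewrite QE -mul_polyC mupMr ?rootC // mup_prod_XsubC -[nat_of_bool _]/1%N => <-.
  rewrite /s2 count_filter; apply: eq_count => d /=; case: eqP => [->|//].
  by rewrite c1.
have cop : coprimep Q1 ('X^m - 1).
  rewrite /Q1 big_seq; apply: (big_rec (fun q => coprimep q ('X^m - 1))).
    exact: coprime1p.
  move=> c q; rewrite mem_filter => /andP[c1 _] copq.
  rewrite coprimepMl copq andbT coprimep_sym coprimep_XsubC rootE hornerD hornerN hornerXn hornerC.
  rewrite subr_eq0; apply/eqP => /(congr1 (@normc R)); rewrite normcX normc1 => /eqP.
  by rewrite pexpr_eq1 ?normc_ge0 // => /eqP e; rewrite e ltxx in c1.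
have Q1Xw : kills (Q1 * ('X^m - 1)) w.
  apply: kills_dvdp Qw; rewrite QE dvdpZl //.
  rewrite (perm_big (s1 ++ s2)) /=; last by rewrite perm_sym perm_filterC.
  by rewrite big_cat; apply: dvdp_mul.
have [[f g] /= fg] := Bezout_eq1_coprimepP _ _ cop.
(* In [f * Q1 + g * ('X^m - 1) = 1], the first term sends [w] to a sequence killed by ['X^m - 1],
   the second to one killed by [Q1]. *)
exists (shiftp (f * Q1) w).
  have : kills ('X^m - 1) (shiftp (f * Q1) w).
    by rewrite -kills_shiftp mulrCA; apply: kills_mull; rewrite mulrC.
  move=> [k0 h]; exists k0 => k /h /eqP.
  by rewrite shiftpB shiftpXn (@shiftpC _ 1) mul1r subr_eq0 => /eqP.
apply: (@vanishing_eventually (shiftp (g * ('X^m - 1)) w) _ 0).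
  move=> k _; have := shiftpD (f * Q1) (g * ('X^m - 1)) w k.
  by rewrite fg (@shiftpC _ 1) mul1r => ->; rewrite addrAC subrr add0r.
apply: (@kills_lt1_vanishing s1); first by apply/allP => c; rewrite mem_filter => /andP[].
by rewrite -kills_shiftp mulrCA; apply: kills_mull.
Qed.

Lemma asymp_periodic_cauchy w m : (0 < m)%N ->
  (exists2 p, ev_periodic p m & vanishing (fun k => w k - p k)) ->
  forall e : R, 0 < e -> exists k0, forall k l, (k0 <= k)%N -> (k0 <= l)%N ->
    k = l %[mod m] -> normc (w k - w l) < e.
Proof.
move=> m0 [p [k0 pm] hv] e e0.
have [k1 h] : exists k1, forall k, (k1 <= k)%N -> normc (w k - p k) < e / 2.
  by apply: hv; lra.
have pjm k j : (k0 <= k)%N -> p (k + j * m)%N = p k.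
  move=> lek; elim: j => [|j IH]; first by rewrite addn0.
  by rewrite mulSn addnCA addnC pm // (leq_trans lek) ?leq_addr.
exists (maxn k0 k1) => k l; rewrite !geq_max => /andP[lek0 lek1] /andP[lel0 lel1] kl.
have pkl : p k = p l.
  wlog le : k l {lek0 lek1 lel1 kl} lek0 lel0 kl / (k <= l)%N.
    by move=> W; case/orP: (leq_total k l) => le; [apply: W | apply/esym/W].
  have /dvdnP[j e'] : (m %| l - k)%N by rewrite -eqn_mod_dvd // kl.
  by rewrite -(subnKC le) e' pjm.
have -> : w k - w l = (w k - p k) + - (w l - p l) by rewrite pkl; ring.
apply: le_lt_trans (le_normcD _ _) _; rewrite normcN.
have := h _ lek1; have := h _ lel1; lra.
Qed.

End Asymptotics.

(** * Eventual periodicity and Fatou's lemma *)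

(** The bound on [j] limits the period, which backward periodicity requires. *)
Lemma pigeonhole (T : finType) (f : nat -> T) a :
  exists i j, [/\ (a <= i)%N, (i < j)%N, (j <= a + #|T|)%N & f i = f j].
Proof.
pose g (i : 'I_#|T|.+1) := f (a + i)%N.
have /injectivePn[i [j ne_ij eq_ij]] : ~~ injectiveb g.
  apply/injectiveP => /leq_card; by rewrite card_ord ltnn.
wlog lt_ij : i j ne_ij eq_ij / (i < j)%N => [W|].
  case: (ltngtP i j) => [lt|lt|/val_inj e]; first exact: (W i j).
    by apply: (W j i) => //; rewrite eq_sym.
  by rewrite e eqxx in ne_ij.
exists (a + i)%N, (a + j)%N; split=> //; first exact: leq_addr.
- by rewrite ltn_add2l.
- by rewrite leq_add2l -ltnS.
Qed.

Section FiniteStatePeriodicity.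
Variables (T : finType) (f : nat -> T) (k0 : nat).

Lemma ev_periodic_forward :
  (forall k l, (k0 <= k)%N -> (k0 <= l)%N -> f k = f l -> f k.+1 = f l.+1) ->
  exists2 m, (0 < m)%N & ev_periodic f m.
Proof.
move=> step; have [i [j [le_i lt_ij _ eq_ij]]] := pigeonhole f k0.
exists (j - i)%N; first by rewrite subn_gt0.
exists i => k le_k; rewrite -(subnKC le_k); elim: (k - i)%N => [|l IH].
  by rewrite addn0 subnKC ?(ltnW lt_ij).
rewrite addnS addSn; apply: step => //; rewrite -?addnA (leq_trans le_i) ?leq_addr //.
Qed.

(** A repetition far beyond [k] is carried back to [k]. Its period depends on [k] but is at most
    [#|T|], so the factorial of [#|T|] is a common period. *)
Lemma ev_periodic_backward :
  (forall k l, (k0 <= k)%N -> (k0 <= l)%N -> f k.+1 = f l.+1 -> f k = f l) ->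
  exists2 m, (0 < m)%N & ev_periodic f m.
Proof.
move=> step; exists (#|T|)`!; first exact: fact_gt0.
exists k0 => k le_k.
(* Starting at [k] plus the factorial keeps all the steps of length [p] made from [k] below [i], in
   the range of [down]. *)
have [i [j [le_i lt_ij le_j eq_ij]]] := pigeonhole f (k + (#|T|)`!).
pose p := (j - i)%N.
have p_gt0 : (0 < p)%N by rewrite subn_gt0.
have le_p : (p <= #|T|)%N by rewrite leq_subLR (leq_trans le_j) // leq_add2r.
have down t : (k0 <= t)%N -> (t <= i)%N -> f (t + p)%N = f t.
  move=> le_t le_ti; rewrite -(subKn le_ti); elim: (i - t)%N (leq_subr t i) (leq_sub2l i le_t) => [|s IH] le_s le_s'.
    by rewrite subn0 subnKC ?(ltnW lt_ij).
  have lt_s : (s < i)%N by [].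
  have e : (i - s = (i - s.+1).+1)%N by rewrite -subSn.
  apply: step.
  - by move: le_s' le_t le_ti; lia.
  - by move: le_s' le_t le_ti; lia.
  - by rewrite -addSn -e; apply: IH; lia.
have /dvdnP[q Eq] : (p %| (#|T|)`!)%N by rewrite dvdn_fact // p_gt0.
rewrite Eq in le_i *; elim: q {Eq} le_i => [|q IH] le_i; first by rewrite addn0.
rewrite mulSn addnCA addnC down; first by apply: IH; move: le_i; rewrite mulSn; lia.
- by rewrite (leq_trans le_k) ?leq_addr.
- by move: le_i; rewrite mulSn; lia.
Qed.

End FiniteStatePeriodicity.

Section WindowPeriodicity.
Variables (T : eqType) (s : seq T) (u : nat -> T) (d k0 : nat).
Hypothesis us : forall k, (k0 <= k)%N -> u k \in s.

(** Windows are coded by indices in [s], in a finite type to which the pigeonhole principle applies.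
    They have [d + 1] terms, so that [u k] belongs to its window even if [d = 0]. *)
Let window k : {ffun 'I_d.+1 -> 'I_(size s).+1} :=
  [ffun i : 'I_d.+1 => inord (index (u (k + i)%N) s)].

Let window_eq k l i : (k0 <= k)%N -> (k0 <= l)%N -> (i <= d)%N ->
  window k = window l -> u (k + i)%N = u (l + i)%N.
Proof.
move=> le_k le_l le_i /ffunP/(_ (inord i)); rewrite !ffunE inordK // => /(congr1 val).
rewrite /= !inordK ?ltnS ?index_size // => e.
rewrite -(nth_index (u k) (us (leq_trans le_k (leq_addr i k)))) e nth_index // us //.
by rewrite (leq_trans le_l) ?leq_addr.
Qed.

Let eq_window k l : (forall i, (i <= d)%N -> u (k + i)%N = u (l + i)%N) ->
  window k = window l.
Proof. by move=> h; apply/ffunP => i; rewrite !ffunE h // -ltnS. Qed.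

Let window_periodic m : ev_periodic window m -> ev_periodic u m.
Proof.
move=> [k1 h]; exists (maxn k0 k1) => k; rewrite geq_max => /andP[le0 le1].
rewrite -[X in u X = _]addn0 -[X in _ = u X]addn0; apply: window_eq => //; last exact: h.
by rewrite (leq_trans le0) ?leq_addr.
Qed.

Lemma window_forward_periodic :
  (forall k l, (k0 <= k)%N -> (k0 <= l)%N ->
     (forall i, (i < d)%N -> u (k + i)%N = u (l + i)%N) -> u (k + d)%N = u (l + d)%N) ->
  exists2 m, (0 < m)%N & ev_periodic u m.
Proof.
move=> step; have [|m m0 /window_periodic h] := @ev_periodic_forward _ window k0.
  move=> k l le_k le_l e; apply: eq_window => i.
  rewrite leq_eqVlt => /predU1P[->|lt_i]; last first.
    by rewrite !addSnnS; apply: window_eq e.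
  apply: step; rewrite ?leqW // => j lt_j.
  by rewrite !addSnnS; apply: window_eq e.
by exists m.
Qed.

Lemma window_backward_periodic :
  (forall k l, (k0 <= k)%N -> (k0 <= l)%N ->
     (forall i, (i < d)%N -> u (k.+1 + i)%N = u (l.+1 + i)%N) -> u k = u l) ->
  exists2 m, (0 < m)%N & ev_periodic u m.
Proof.
move=> step; have [|m m0 /window_periodic h] := @ev_periodic_backward _ window k0.
  move=> k l le_k le_l e; apply: eq_window => -[_|i lt_i].
    rewrite !addn0; apply: step => // i lt_i.
    by apply: window_eq e; rewrite ?leqW // ltnW.
  by rewrite -!addSnnS; apply: window_eq e; rewrite ?leqW // ltnW.
by exists m.
Qed.

End WindowPeriodicity.

Section RationalRecurrence.
Variables (K : fieldType) (A : {poly K}).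
Hypothesis A0 : A != 0.
Let r := (size A).-1.

Lemma shiftp_lead u k : shiftp A u k = 0 ->
  u (k + r)%N = \sum_(i < r) - (A`_i / lead_coef A) * u (k + i)%N.
Proof.
rewrite /shiftp -(prednK (_ : 0 < size A)%N) ?size_poly_gt0 // big_ord_recr /= -/r.
move=> /eqP; rewrite addrC addr_eq0 -lead_coefE => /eqP e.
apply: (mulfI (_ : lead_coef A != 0)); first by rewrite lead_coef_eq0.
rewrite e mulr_sumr -sumrN; apply: eq_bigr => i _.
by rewrite mulNr mulrN mulrA mulrCA divff ?mulr1 // lead_coef_eq0.
Qed.

Lemma recurrence_eventually0 u k0 : (forall k, (k0 <= k)%N -> shiftp A u k = 0) ->
  (forall i, (i < r)%N -> u (k0 + i)%N = 0) -> forall k, (k0 <= k)%N -> u k = 0.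
Proof.
move=> Au u0 k le_k; rewrite -(subnKC le_k); elim/ltn_ind: (k - k0)%N => j IH.
have [/u0//|le_j] := ltnP j r.
rewrite -(subnK le_j) addnA shiftp_lead ?Au ?leq_addr // big1 // => i _.
by rewrite -addnA IH ?mulr0 // -{2}(subnK le_j) ltn_add2l.
Qed.

End RationalRecurrence.

Lemma rat_common_denominator (T : finType) (c : T -> rat) :
  exists2 d : nat, (0 < d)%N & exists z : T -> int, forall t, d%:R * c t = (z t)%:~R.
Proof.
pose d := \prod_t `|denq (c t)|%N.
have d0 : (0 < d)%N by apply: prodn_gt0 => t; rewrite absz_gt0 denq_eq0.
exists d => //.
exists (fun t => (\prod_(s | s != t) `|denq (c s)|)%N%:Z * numq (c t)) => t.
rewrite /d (bigD1 t) //= natrM mulrAC mulrC rmorphM /= -pmulrn; congr (_ * _).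
rewrite -[in X in _ * X](divq_num_den (c t)).
rewrite (_ : (`|denq (c t)|%N%:R : rat) = (denq (c t))%:~R); last by rewrite -{2}absz_denq pmulrn.
by rewrite mulrC divfK // intr_eq0 denq_eq0.
Qed.

(* Fatou: the windows of [Y] of length [deg A] lie in the rational span of
   the first [deg A] of them, with coordinates of bounded denominator [d];
   two windows with coordinates congruent modulo [1] yield a monic relation. *)
Lemma int_recurrence_monic (A : {poly int}) (Y : nat -> int) : A != 0 ->
  kills A Y -> exists2 B : {poly int}, B \is monic & kills B Y.
Proof.
move=> A0 [k0 AY]; pose Aq := int_poly rat A; pose r := (size Aq).-1.
have Aq0 : Aq != 0 by rewrite map_poly_eq0_id0 // intr_eq0 lead_coef_eq0.
pose y k : rat := (Y (k0 + k)%N)%:~R.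
have Ay k : shiftp Aq y k = 0.
  have := shiftp_map (intr : {rmorphism int -> rat}) A Y (k0 + k)%N.
  rewrite AY ?leq_addr // rmorph0 => h; rewrite -[RHS]h.
  by apply: eq_bigr => i _; rewrite /y /= addnA.
pose v j : 'rV[rat]_r := \row_i y (j + i)%N.
pose M : 'M[rat]_r := \matrix_(i, l) v i 0 l.
have rowM i : row i M = v i by apply/rowP => l; rewrite !mxE.
have vM j : (v j <= M)%MS.
  elim/ltn_ind: j => j IH; have [lt_j|le_j] := ltnP j r.
    by rewrite -(rowM (Ordinal lt_j)) row_sub.
  suff -> : v j = \sum_(i < r) - (Aq`_i / lead_coef Aq) *: v (j - r + i)%N.
    apply: summx_sub => i _; apply: scalemx_sub; apply: IH.
    by rewrite -{2}(subnK le_j) ltn_add2l.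
  apply/rowP => l; rewrite summxE mxE -{1}(subnK le_j) addnAC.
  rewrite (shiftp_lead Aq0) ?Ay //; apply: eq_bigr => i _.
  by rewrite !mxE addnAC.
(* One matrix gives the coordinates of every window, so [d] clears all their denominators at
   once. *)
have [d d0 [z zE]] := rat_common_denominator (fun p : 'I_r * 'I_r => pinvmx M p.1 p.2).
pose c j := v j *m pinvmx M.
have cM j : c j *m M = v j by rewrite mulmxKpV.
pose e j (l : 'I_r) : int := \sum_(i < r) Y (k0 + (j + i))%N * z (i, l).
have eE j l : d%:R * c j 0 l = (e j l)%:~R.
  rewrite mxE mulr_sumr rmorph_sum; apply: eq_bigr => i _.
  by rewrite rmorphM /= -zE mxE mulrCA.
have d0z : (d%:Z != 0) by rewrite eqz_nat -lt0n.
have lt_res j l : (`|(e j l %% d)%Z|%N < d)%N.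
  by rewrite -ltz_nat gez0_abs ?modz_ge0 // ltz_pmod.
(* Starting at [r] gives [l < r <= i < j] below, so that ['X^j] is the leading term of the
   relation. *)
have [i [j [le_i lt_ij _ eq_ij]]] := pigeonhole (fun j => [ffun l => Ordinal (lt_res j l)]) r.
have modE l : exists q : int, e j l - e i l = q * d%:Z.
  have := congr1 (fun g : {ffun 'I_r -> 'I_d} => val (g l)) eq_ij; rewrite !ffunE /= => h.
  have /eqP : (e i l %% d)%Z = (e j l %% d)%Z.
    by rewrite -(@gez0_abs (e i l %% d)%Z) ?modz_ge0 // h gez0_abs ?modz_ge0.
  by rewrite eq_sym eqz_mod_dvd => /dvdzP[q]; exists q.
have /choice[q qE] := modE.
have yE t : (t < r)%N -> Y (k0 + (j + t))%N - Y (k0 + (i + t))%N = \sum_(l < r) q l * Y (k0 + (l + t))%N.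
  move=> lt_t; apply: (@intr_inj rat); rewrite rmorphB rmorph_sum /=.
  have vE m : (Y (k0 + (m + t))%N)%:~R = v m 0 (Ordinal lt_t) by rewrite mxE.
  have cE m : v m 0 (Ordinal lt_t) = \sum_(l < r) c m 0 l * v l 0 (Ordinal lt_t).
    by rewrite -{1}cM mxE; apply: eq_bigr => l _; rewrite [M _ _]mxE.
  rewrite !vE (cE j) (cE i) -sumrB; apply: eq_bigr => l _.
  rewrite -mulrBl rmorphM /= vE; congr (_ * _).
  apply: (mulfI (_ : d%:R != 0)); first by rewrite pnatr_eq0 -lt0n.
  by rewrite mulrBr !eE -rmorphB /= qE rmorphM /= mulrC -pmulrn.
pose G : {poly int} := 'X^i + \sum_(l < r) q l *: 'X^l.
have sG : (size G < size ('X^j : {poly int}))%N.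
  rewrite size_polyXn ltnS; apply: (leq_trans (size_polyD _ _)).
  rewrite geq_max size_polyXn lt_ij /=; apply: (leq_trans (size_sum _ _ _)).
  apply/bigmax_leqP => l _; apply: (leq_trans (size_scale_leq _ _)).
  by rewrite size_polyXn (leq_trans (ltn_ord l)) // (leq_trans le_i) // ltnW.
exists ('X^j - G).
  by rewrite monicE lead_coefDl ?size_polyN // lead_coefXn.
have DY k : shiftp ('X^j - G) Y k = Y (k + j)%N - Y (k + i)%N - \sum_(l < r) q l * Y (k + l)%N.
  rewrite shiftpB shiftpXn /G shiftpD shiftpXn opprD addrA; congr (_ - _).
  elim: (index_enum _) => [|l s IH]; first by rewrite !big_nil shiftp0.
  by rewrite !big_cons shiftpD IH shiftpZ shiftpXn.
exists k0 => k le_k; apply: (@intr_inj rat); rewrite rmorph0.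
(* The defect of the new relation also satisfies the recurrence [Aq], so it suffices that its first
   [r] terms vanish, which is [yE]. *)
apply: (@recurrence_eventually0 _ Aq Aq0 (fun k => (shiftp ('X^j - G) Y k)%:~R) k0) le_k.
  move=> m le_m; rewrite (shiftp_map (intr : {rmorphism int -> rat}) A (shiftp ('X^j - G) Y)).
  by rewrite -shiftpM mulrC shiftpM (shiftp_eventually0 _ AY le_m) rmorph0.
move=> t lt_t; rewrite DY -!addnA (addnC t j) (addnC t i) yE //.
under [X in _ - X]eq_bigr do rewrite -addnA (addnC t).
by rewrite subrr rmorph0.
Qed.

(** * Approximation by rational recurrent sequences *)

Lemma int_poly_eq0 (K : numDomainType) (A : {poly int}) : (int_poly K A == 0) = (A == 0).
Proof.
apply/eqP/eqP => [A0|->]; last by rewrite /int_poly rmorph0.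
apply/polyP => i; apply: (@intr_inj K).
by rewrite -[LHS]coef_map /= -/(int_poly K A) A0 !coef0.
Qed.

Lemma map_int_poly (K L : comNzRingType) (f : {rmorphism K -> L}) (A : {poly int}) :
  map_poly f (int_poly K A) = int_poly L A.
Proof. by apply/polyP => i; rewrite !coef_map /= rmorph_int. Qed.

Lemma kills_intr (K : comNzRingType) (A : {poly int}) (Y : nat -> int) :
  kills A Y -> kills (int_poly K A) (fun k => (Y k)%:~R).
Proof. exact: (@kills_map int K intr A Y). Qed.

Section CharacteristicRoots.
Variable R : realType.
Variables (X y : nat -> R[i]).
Let z k := X k - y k.

(** If [b] is not a root of [B], then [X = z + y] is killed by a polynomial in which [b] has
    multiplicity at most [e]. *)
Lemma component_size_or_integral (B : {poly int}) b H e : b != 0 ->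
  B \is monic -> kills (int_poly R[i] B) y -> has_component X b H ->
  mult_at_most z b e -> (size H <= e)%N \/ algebraic_integer b.
Proof.
move=> b0 Bmonic By Xb [C Cb Cz].
have [Bb|Bb] := boolP (root (int_poly R[i] B) b); first by right; exists B.
left; have DX : kills (('X - b%:P) ^+ e * C * int_poly R[i] B) X.
  apply: (@kills_eventually _ _ (fun k => z k + y k) _ 0); first by move=> k _; rewrite subrK.
  by apply: killsD; [apply: kills_mulr | apply: kills_mull].
have := has_component_dvdp b0 DX Xb; rewrite -mulrA Gauss_dvdpl; last first.
  by apply: coprimep_exp_XsubC; rewrite hornerM mulf_neq0.
move=> /dvdp_leq; rewrite expf_neq0 ?polyXsubC_eq0 // !size_exp_XsubC ltnS.
exact.
Qed.

(** As [sigma] fixes [y], the sequences [sigma \o X - X] and [sigma \o z - z] agree. The first has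
    component [map_poly sigma H - G] at [sigma b]; in the second, [sigma b] has multiplicity at most
    [e]. *)
Lemma conjugate_component_size (sigma : {rmorphism R[i] -> R[i]}) b H G e : b != 0 ->
  (forall k, sigma (y k) = y k) ->
  has_component X b H -> has_component X (sigma b) G ->
  mult_at_most z b e -> mult_at_most z (sigma b) e ->
  (size (map_poly sigma H - G)%R <= e)%N.
Proof.
move=> b0 ysigma Xb Xsb [C Cb Cz] [C' Cb' Cz'].
have /(has_component_map sigma) sXb := Xb.
have DX : kills (('X - (sigma b)%:P) ^+ e * (C' * map_poly sigma C)) (fun k => (sigma \o X) k - X k).
  apply: (@kills_eventually _ _ (fun k => (sigma \o z) k - z k) _ 0).
    by move=> k _; rewrite /z /= rmorphB ysigma; ring.
  apply: killsB; last by rewrite mulrA; apply: kills_mulr.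
  rewrite mulrCA; apply: kills_mull; have := kills_map sigma Cz.
  by rewrite rmorphM rmorphXn /= rmorphB /= map_polyX map_polyC.
have sb0 : sigma b != 0 by rewrite fmorph_eq0.
have := has_component_dvdp sb0 DX (has_componentB sXb Xsb).
rewrite Gauss_dvdpl; last first.
  by apply: coprimep_exp_XsubC; rewrite hornerM mulf_neq0 // horner_map fmorph_eq0.
move=> /dvdp_leq; rewrite expf_neq0 ?polyXsubC_eq0 // !size_exp_XsubC ltnS.
exact.
Qed.

End CharacteristicRoots.

Section Approximation.
Variables (R : realType) (P : {poly int}) (x : nat -> R).
Variables (n : nat) (alpha : 'I_n -> R[i]) (F : 'I_n -> {poly R[i]}).
Hypothesis P0 : P != 0.
Hypothesis Px : kills (int_poly R P) x.
Hypothesis inj_alpha : injective alpha.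
Hypothesis xE : forall k : nat, (1 <= k)%N ->
  (x k)%:C%C = \sum_(i < n) (F i).[k%:R] * alpha i ^+ k.

Variables (Y : nat -> int) (N : nat) (B : {poly int}).
Hypothesis B0 : B != 0.
Hypothesis BY : kills B Y.

Let X k : R[i] := (x k)%:C%C.
Let y k : R[i] := N%:R^-1 * (Y k)%:~R.
Let z k := X k - y k.

Let zE k : z k = (x k - (Y k)%:~R / N%:R)%:C%C.
Proof. by rewrite /z /X /y rmorphB /= fmorph_div /= rmorph_int rmorph_nat mulrC. Qed.

Let PBz : kills (int_poly R[i] (P * B)) z.
Proof.
rewrite /int_poly rmorphM /=; apply: killsB.
  apply: kills_mulr; rewrite -/(int_poly _ _) -(map_int_poly (real_complex R)).
  exact: (@kills_map _ _ (real_complex R)).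
by apply: kills_mull; apply: killsZ; apply: kills_intr.
Qed.

Let PB0 : int_poly R[i] (P * B) != 0.
Proof. by rewrite int_poly_eq0 mulf_neq0. Qed.

Let Xcomp i : has_component X (alpha i) (F i).
Proof. exact: exppoly_sum_has_component. Qed.

Let ysigma (sigma : {rmorphism R[i] -> R[i]}) k : sigma (y k) = y k.
Proof. by rewrite /y rmorphM fmorphV rmorph_nat rmorph_int. Qed.

Let norm_neq0 (b : R[i]) : 1 <= normc b -> b != 0.
Proof. by apply: contraTneq => ->; rewrite normc0 -ltNge. Qed.

(** Boundedness leaves multiplicity [0] at moduli above [1], which refutes (a) and (c), and at most
    [1] at modulus [1], which refutes (b) and (d). *)
Lemma bounded_approximation (c : R) k0 :
  (forall k, (k0 <= k)%N -> `|x k - (Y k)%:~R / N%:R| <= c) ->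
  ~ (cond_a alpha F \/ cond_b alpha F \/ cond_c alpha F \/ cond_d alpha F).
Proof.
move=> bnd; have bz : ev_bounded z.
  by exists c, k0 => k /bnd; rewrite zE normc_real.
have mult := ev_bounded_mult_at_most PB0 PBz bz.
have [M Mmonic MY] := int_recurrence_monic B0 BY.
have My : kills (int_poly R[i] M) y by apply: killsZ; apply: kills_intr.
case=> [[i [Fi ai nalg]]|[[i [Fi ai nalg]]|[[i [j [s [_ ai aj sij]]]]|[i [j [s [_ ai aj sij]]]]]]].
- rewrite normc_gt1 in ai.
  have [|//] := component_size_or_integral (norm_neq0 (ltW ai)) Mmonic My (Xcomp i) (mult _ 0 (or_introl ai)).
  by rewrite leqn0 size_poly_eq0 (negPf Fi).
- move/normc_eq1 in ai.
  have ai1 : 1 <= normc (alpha i) by rewrite ai.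
  have [|//] := component_size_or_integral (norm_neq0 ai1) Mmonic My (Xcomp i) (mult _ 1 (or_intror (conj ai isT))).
  by rewrite leqNgt Fi.
- rewrite normc_gt1 in ai; rewrite normc_gt1 -sij in aj.
  have Xj : has_component X (s (alpha i)) (F j) by rewrite sij.
  have := conjugate_component_size (norm_neq0 (ltW ai)) (ysigma s) (Xcomp i) Xj (mult _ 0 (or_introl ai)) (mult _ 0 (or_introl aj)).
  by rewrite leqn0 size_poly_eq0 subr_eq0 => ->.
- rewrite normc_ge1 in ai; rewrite normc_ge1 -sij in aj.
  have Xj : has_component X (s (alpha i)) (F j) by rewrite sij.
  have m1 b : 1 <= normc b -> mult_at_most z b 1.
    rewrite le_eqVlt => /predU1P[b1|b1]; apply: mult; [right|left] => //.
  have := conjugate_component_size (norm_neq0 ai) (ysigma s) (Xcomp i) Xj (m1 _ ai) (m1 _ aj).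
  by rewrite leqNgt => /negPf->.
Qed.

(** Since [alpha i] has modulus above [1], it is no root of unity; nor is its conjugate [alpha j],
    even if of modulus [1]. Hence both have multiplicity [0]. *)
Lemma asymp_periodic_approximation (p : nat -> R) m : (0 < m)%N -> ev_periodic p m ->
  (forall e : R, 0 < e -> exists k0, forall k, (k0 <= k)%N ->
     `|x k - (Y k)%:~R / N%:R - p k| < e) ->
  ~ cond_e alpha F.
Proof.
move=> m0 [k0 pm] cvg [i [j [s [_ ai aj sij]]]].
rewrite normc_gt1 in ai; rewrite normc_ge1 -sij in aj.
have vz : vanishing (fun k => z k - (p k)%:C%C).
  by move=> e /cvg[k1 h]; exists k1 => k /h; rewrite zE -rmorphB normc_real.
have pC : ev_periodic (fun k => (p k)%:C%C : R[i]) m by exists k0 => k /pm ->.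
have aim : alpha i ^+ m != 1.
  apply: contraTneq ai => aim; rewrite -leNgt.
  by rewrite (@root_of_unity_normc _ (alpha i)) //; exists m.
have saim : s (alpha i) ^+ m != 1 by rewrite -rmorphXn fmorph_eq1.
have mult b := asymp_periodic_mult_at_most (b := b) PB0 PBz pC vz.
have Xj : has_component X (s (alpha i)) (F j) by rewrite sij.
have := conjugate_component_size (norm_neq0 (ltW ai)) (ysigma s) (Xcomp i) Xj (mult _ (ltW ai) aim) (mult _ aj saim).
by rewrite leqn0 size_poly_eq0 subr_eq0 => ->.
Qed.

End Approximation.

(** * Limit values on the circle *)

Section Circle.
Variable R : realType.
Implicit Types (u : nat -> R) (V : set R).

Lemma circle_proj_sub_int (t : R) (m : int) : circle_proj (t - m%:~R) = circle_proj t.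
Proof. by apply/circle_proj_eq; rewrite addrAC subrr add0r rpredN intr_int. Qed.

Lemma circle_proj_surj (c : circle R) : exists t, c = circle_proj t.
Proof. by exists (repr c); rewrite /circle_proj reprK. Qed.

Lemma circle_compact : compact [set: circle R].
Proof.
have -> : [set: circle R] = @circle_proj R @` `[0, 1]%classic.
  apply/seteqP; split=> // c _; have [t ->] := circle_proj_surj c.
  exists (t - (Num.floor t)%:~R); last exact: circle_proj_sub_int.
  rewrite /= in_itv /=; have /andP[] := floor_itv t; rewrite intrD; lra.
apply: continuous_compact; last exact: segment_compact.
by apply: continuous_subspaceT => t; apply: circle_proj_continuous.
Qed.

(** Openness in the quotient is openness of the preimage, here the union of the integer translates
    of [V]. *)
Lemma circle_proj_image_open V : open V -> open (@circle_proj R @` V).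
Proof.
move=> oV; suff h : open (@circle_proj R @^-1` (@circle_proj R @` V)) by exact: h.
have -> : @circle_proj R @^-1` (@circle_proj R @` V) =
    \bigcup_(m in [set: int]) ((fun t => t - m%:~R) @^-1` V).
  apply/seteqP; split=> t /=.
    move=> [s Vs] /circle_proj_eq /intrP[m e]; exists (- m) => //=.
    by rewrite rmorphN /= opprK -e addrC subrK.
  move=> [m _ /= Vt]; exists (t - m%:~R) => //.
  exact: circle_proj_sub_int.
apply: bigcup_open => m _; apply: open_comp => // t _.
by apply: continuousB; [exact: cvg_id | exact: cvg_cst].
Qed.

(** Otherwise [u] is outside the image of [V] along indices [phi k >= k]. By compactness it has a
    cluster point there, a limit value of the whole sequence, and the open image of [V] is a
    neighbourhood of it. *)
Lemma limit_values_sub_open u V : open V ->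
  limit_values (fun k => circle_proj (u k)) `<=` @circle_proj R @` V ->
  exists k0, forall k, (k0 <= k)%N -> exists m : int, V (u k - m%:~R).
Proof.
move=> oV sub; apply: contrapT => /forallNP h.
have /choice[phi phiP] : forall k0, exists k, (k0 <= k)%N /\ ~ (@circle_proj R @` V) (circle_proj (u k)).
  move=> k0; have /existsNP[k /not_implyP[le_k nV]] := h k0; exists k; split=> //.
  move=> [t Vt] /circle_proj_eq /intrP[m e]; apply: nV; exists (- m).
  by rewrite rmorphN /= opprK -e addrC subrK.
pose G := (fun k => circle_proj (u (phi k))) @ \oo.
have [c [_ cG]] : [set: circle R] `&` cluster G !=set0.
  by apply: circle_compact; apply: filterT.
have Uc : (@circle_proj R @` V) c.
  apply: sub => A B [k0 _ hA] nB; apply: cG => //.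
  exists k0 => // k /= le_k; apply: hA => /=.
  by have [le_phi _] := phiP k; apply: leq_trans le_phi.
have [||d [Ad Bd]] := cG (~` (@circle_proj R @` V)) (@circle_proj R @` V).
- by exists 0 => // k _; have [_] := phiP k.
- exact: (open_nbhs_nbhs (conj (circle_proj_image_open oV) Uc)).
- exact: Ad.
Qed.

(** A nonempty interval of finite measure is bounded, and adding its ends does not change its
    length. *)
Lemma in_short_interval_segment l (A : set (circle R)) : in_short_interval l A ->
  exists a b, b - a < l /\ A `<=` @circle_proj R @` [set t | a <= t <= b].
Proof.
move=> [I [mI AI]].
have l0 : 0 < l by rewrite -lte_fin; apply: le_lt_trans mI; apply: measure_ge0.
have [I0|I0] := eqVneq ([set` I] : set R) set0.
  by exists 0, 0; split; [rewrite subrr | move: AI; rewrite I0 image_set0 => /subset_trans; apply].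
suff [a [b [ab Iab]]] : exists a b, b - a < l /\ [set` I] `<=` [set t : R | a <= t <= b].
  exists a, b; split=> //; apply: (subset_trans AI); exact: image_subset.
move: mI I0; rewrite lebesgue_measure_itv {AI}.
case: I => [[x a|[]] [y b|[]]] /=; rewrite ?ltry ?ltNyr ?lte_fin //=.
- move=> ab _; exists a, b; split.
    by move: ab; have [lt_ab|le_ba] := ltP a b; [rewrite -EFinB lte_fin | move=> _; lra].
  by case: x; case: y => t /=; rewrite in_itv /= => /andP[h1 h2]; rewrite ?h1 ?h2 ?(ltW h1) ?(ltW h2).
- by rewrite set_itv_ge ?eqxx.
- by rewrite set_itv_ge ?eqxx.
- by rewrite set_itv_ge ?eqxx.
- by rewrite set_itv_ge ?eqxx.
- by rewrite set_itv_ge ?eqxx.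
Qed.

Lemma dist_int_lt (x r : R) : dist_int x < r -> exists m : int, `|x - m%:~R| < r.
Proof.
move=> /inf_lt[]; first by exists `|x - 0%:~R|; exists 0.
by move=> _ [m _ <-] h; exists m.
Qed.

Lemma limn_esup_lt (f : nat -> R) (l : R) : (limn_esup (EFin \o f) < l%:E)%E ->
  exists2 r, r < l & exists k0, forall k, (k0 <= k)%N -> f k < r.
Proof.
move=> /ereal_inf_lt[_ [V [k0 _ hV] <-]] sup_lt.
have hf k : (k0 <= k)%N -> ((f k)%:E <= ereal_sup ((EFin \o f) @` V))%E.
  by move=> le_k; apply: ereal_sup_ubound; exists k => //; apply: hV.
case: (ereal_sup _) sup_lt hf => [s||] //; last first.
  by move=> _ /(_ k0 (leqnn _)).
(* The midpoint turns the weak bound by [s] into a strict one, still below [l]. *)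
rewrite lte_fin => lt_s hf; exists ((s + l) / 2); first by lra.
by exists k0 => k /hf; rewrite lee_fin => h; lra.
Qed.

End Circle.

(** * Finitely many limit values: rational approximation *)

Section Approximations.
Variable R : realType.

Lemma norm_shiftp (D : {poly R}) u k (b : R) :
  (forall j, (k <= j)%N -> `|u j| <= b) -> `|shiftp D u k| <= plength D * b.
Proof.
move=> ub; apply: le_trans (ler_norm_sum _ _ _) _; rewrite /plength mulr_suml.
by apply: ler_sum => i _; rewrite normrM ler_wpM2l // ub ?leq_addr.
Qed.

Lemma plength_ge0 (D : {poly R}) : 0 <= plength D.
Proof. by apply: sumr_ge0. Qed.

Lemma int_norm_lt1 (m : int) : `|m%:~R : R| < 1 -> m = 0.
Proof. by rewrite -intr_norm -[ltRHS]/(1%:~R) ltr_int; lia. Qed.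

Lemma shiftp_int_poly (A : {poly int}) (Y : nat -> int) k :
  shiftp (int_poly R A) (fun k => (Y k)%:~R) k = (shiftp A Y k)%:~R.
Proof. exact: (@shiftp_map _ _ (intr : {rmorphism int -> R})). Qed.

Lemma nearest_int (v : R) : exists m : int, forall l : int, `|v - m%:~R| <= `|v - l%:~R|.
Proof.
exists (Num.floor (v + 2^-1)) => l; set m := Num.floor _.
have /andP[h1 h2] := floor_itv (v + 2^-1); rewrite -/m intrD in h1 h2.
have hm : `|v - m%:~R| <= 2^-1 by rewrite ler_norml; lra.
have [->//|ne] := eqVneq l m.
have : 1 <= `|(l - m)%:~R : R| by rewrite -intr_norm -[leLHS]/(1%:~R) ler_int; lia.
rewrite intrB; have := ler_normB (v - m%:~R) (v - l%:~R).
by rewrite (_ : v - m%:~R - (v - l%:~R) = l%:~R - m%:~R); [lra | ring].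
Qed.

(** The gap is the distance from [w] to the integers, or [1] if that distance is zero. *)
Lemma int_translate_gap (w : R) : exists2 e : R, 0 < e &
  forall m : int, `|m%:~R + w| < e -> m%:~R + w = 0.
Proof.
have [m hm] := nearest_int w.
have [z|nz] := eqVneq (w - m%:~R) 0.
  exists 1 => // l; have -> : w = m%:~R by apply/eqP; rewrite -subr_eq0 z.
  by rewrite -intrD => /int_norm_lt1->.
exists `|w - m%:~R|; first by rewrite normr_gt0.
move=> l; rewrite ltNge; have := hm (- l).
by rewrite rmorphN /= opprK (addrC w l%:~R) => ->.
Qed.

Lemma finite_pos_bound (T : finType) (h : T -> R) : (forall t, 0 < h t) ->
  exists2 e : R, 0 < e & forall t, e <= h t.
Proof.
move=> h0; suff [e e0 he] : exists2 e : R, 0 < e & forall t, t \in enum T -> e <= h t.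
  by exists e => // t; apply: he; rewrite mem_enum.
elim: (enum T) => [|t s [e e0 IH]]; first by exists 1.
exists (Num.min e (h t)); first by rewrite lt_min e0 h0.
by move=> l; rewrite inE ge_min => /predU1P[->|/IH->//]; rewrite lexx orbT.
Qed.

(** Solvability of a linear system is a row space inclusion, which field extension does not
    affect. *)
Lemma rational_solution m q (A : 'M[rat]_(m, q)) (b : 'rV[rat]_q) (t : 'rV[R]_m) :
  t *m map_mx ratr A = map_mx ratr b -> exists tau : 'rV[rat]_m, tau *m A = b.
Proof.
move=> tA; have : (map_mx ratr b <= map_mx (ratr : rat -> R) A)%MS.
  by rewrite -tA submxMl.
by rewrite map_submx => /submxP[tau ->]; exists tau.
Qed.

(** The maps [g] with an integer sum at [t] give finitely many rational linear equations solved by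
    [t]; [tau] is a rational solution of the same system. *)
Lemma rational_specialization m d (t : 'I_m -> R) (c : 'I_d -> int) :
  exists tau : 'I_m -> rat, forall (g : {ffun 'I_d -> 'I_m}) (b : int),
    \sum_i (c i)%:~R * t (g i) = b%:~R -> \sum_i (c i)%:~R * tau (g i) = b%:~R.
Proof.
pose w (g : {ffun 'I_d -> 'I_m}) := \sum_i (c i)%:~R * t (g i).
have /choice[b bE] : forall g, exists b : int, w g \is a Num.int -> w g = b%:~R.
  move=> g; have [/intrP[b ->]|_] := boolP (w g \is a Num.int); first by exists b.
  by exists 0.
pose G := {ffun 'I_d -> 'I_m}.
(* A map [g] with a non-integer sum contributes the trivial equation [0 = 0]. *)
pose A : 'M[rat]_(m, #|G|) := \matrix_(l, g)
  if w (enum_val g) \is a Num.int then \sum_(i | enum_val g i == l) (c i)%:~R else 0.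
pose bv : 'rV[rat]_#|G| := \row_g
  if w (enum_val g) \is a Num.int then (b (enum_val g))%:~R else 0.
have sumE (K : comNzRingType) (f : {rmorphism rat -> K}) (s : 'I_m -> K) (g : G) :
    \sum_l s l * f (\sum_(i | g i == l) (c i)%:~R) = \sum_i (c i)%:~R * s (g i).
  rewrite [RHS](partition_big g xpredT) //=; apply: eq_bigr => l _.
  rewrite rmorph_sum mulr_sumr; apply: eq_bigr => i /eqP->.
  by rewrite rmorph_int mulrC.
have [|tau tauA] := @rational_solution _ _ A bv (\row_l t l).
  apply/rowP => g; rewrite !mxE; have [ig|ng] := boolP (w (enum_val g) \is a Num.int).
    rewrite rmorph_int -bE // /w -(sumE _ (ratr : {rmorphism rat -> R})).
    by apply: eq_bigr => l _; rewrite !mxE ig.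
  by rewrite rmorph0 big1 // => l _; rewrite !mxE (negPf ng) rmorph0 mulr0.
exists (tau 0) => g b' wg.
have ig : w g \is a Num.int by rewrite /w wg intr_int.
have -> : b' = b g by apply: (@intr_inj R); rewrite -wg -bE.
have := congr1 (fun M : 'rV_#|G| => M 0 (enum_rank g)) tauA.
rewrite !mxE enum_rankK ig => <-; rewrite -(sumE _ idfun).
by apply: eq_bigr => l _; rewrite mxE enum_rankK ig.
Qed.

(** The pair [(Y k, j k)] minimizes the distance to [x k], so one choice serves every [e]. *)
Lemma finite_limit_values_nearest (x : nat -> R) :
  finite_set (limit_values (fun k => circle_proj (x k))) ->
  exists (m : nat) (t : 'I_m -> R) (Y : nat -> int) (j : nat -> 'I_m),
    forall e : R, 0 < e -> exists k0, forall k, (k0 <= k)%N ->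
      `|x k - ((Y k)%:~R + t (j k))| < e.
Proof.
move=> /finite_seqP[s sE]; pose m := size s.
pose t (i : 'I_m) : R := repr (nth (circle_proj 0) s i).
have near (e : R) : 0 < e -> exists k0, forall k, (k0 <= k)%N ->
    exists (l : int) (i : 'I_m), `|x k - (l%:~R + t i)| < e.
  move=> e0; have [||k0 h] := @limit_values_sub_open _ x (\bigcup_(i in [set: 'I_m]) ball (t i) e).
  - by apply: bigcup_open => i _; apply: ball_open.
  - rewrite sE => c /= cs; have lt_c : (index c s < m)%N by rewrite index_mem.
    have tE : circle_proj (t (Ordinal lt_c)) = c.
      rewrite -[RHS](nth_index (circle_proj 0) cs); exact: reprK.
    exists (t (Ordinal lt_c)) => //.
    by exists (Ordinal lt_c) => //; apply: ballxx.
  - exists k0 => k /h[l [i _ hi]]; exists l, i; move: hi.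
    by rewrite /ball /= distrC opprD addrA.
(* This only shows that ['I_m] is inhabited, so that a minimum exists. *)
have [k1 /(_ k1 (leqnn _)) [_ [i0 _]]] := near 1 ltr01.
have /choice[Yj hYj] : forall k, exists p : int * 'I_m, forall (l : int) (i : 'I_m),
    `|x k - (p.1%:~R + t p.2)| <= `|x k - (l%:~R + t i)|.
  move=> k; have /choice[y hy] := fun i => nearest_int (x k - t i).
  case: (arg_minP (fun i => `|x k - t i - (y i)%:~R|) (isT : xpredT i0)) => i _ hi.
  exists (y i, i) => l i' /=; have := hi i' isT; have := hy i' l.
  by rewrite ![_ + t _]addrC !opprD !addrA => h1 h2; apply: le_trans h2 h1.
exists m, t, (fun k => (Yj k).1), (fun k => (Yj k).2) => e /near[k0 h].
exists k0 => k /h[l [i hi]]; exact: le_lt_trans (hYj k l i) hi.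
Qed.

End Approximations.

Section FinitelyManyLimitValues.
Variables (R : realType) (P : {poly int}) (x : nat -> R).
Hypothesis P0 : P != 0.
Hypothesis Px : kills (int_poly R P) x.

Lemma finite_limit_values_approximation :
  finite_set (limit_values (fun k => circle_proj (x k))) ->
  exists (Y : nat -> int) (N : nat) (p : nat -> R) (m : nat) (c : R),
    [/\ kills P Y, (0 < m)%N, ev_periodic p m, forall k, `|p k| <= c &
      forall e : R, 0 < e -> exists k0, forall k, (k0 <= k)%N ->
        `|x k - (Y k)%:~R / N%:R - p k| < e].
Proof.
move=> /finite_limit_values_nearest[m [t [Y [j near]]]].
pose d := size P; pose u (i : 'I_d) : int := P`_i.
have [tau tauP] := rational_specialization t u.
have [N N0 [z zE]] := rat_common_denominator tau.
pose g k : {ffun 'I_d -> 'I_m} := [ffun i : 'I_d => j (k + i)%N].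
pose w (f : {ffun 'I_d -> 'I_m}) : R := \sum_i (u i)%:~R * t (f i).
have /choice[gap gapP] : forall f, exists e : R, 0 < e /\
    forall l : int, `|l%:~R + w f| < e -> l%:~R + w f = 0.
  by move=> f; have [e e0 he] := int_translate_gap (w f); exists e.
have [e e0 le_gap] : exists2 e : R, 0 < e & forall f, e <= gap f.
  by apply: finite_pos_bound => f; have [] := gapP f.
pose L := plength (int_poly R P).
have L0 : 0 <= L by apply: plength_ge0.
have [k0 hk0] : exists k0, forall k, (k0 <= k)%N ->
    `|x k - ((Y k)%:~R + t (j k))| < e / (L + 1).
  by apply: near; apply: divr_gt0 => //; lra.
have [k1 hk1] := Px.
have wE k : shiftp (int_poly R P) (t \o j) k = w (g k).
  rewrite (@shiftp_wide _ _ _ d) ?size_poly //; apply: eq_bigr => i _.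
  by rewrite ffunE coef_map.
(* Applied to [Y + t \o j], the recurrence gives an element of the coset of the integers through
   [w (g k)]. It is close to its value [0] at [x], hence zero. *)
have YwE k : (maxn k0 k1 <= k)%N -> (shiftp P Y k)%:~R + w (g k) = 0.
  rewrite geq_max => /andP[le0 le1]; have [_ hg] := gapP (g k).
  apply: hg; apply: lt_le_trans (le_gap (g k)); rewrite -shiftp_int_poly -wE -shiftpDr.
  rewrite -normrN -sub0r -(hk1 k le1) -shiftpBr.
  apply: (@le_lt_trans _ _ (L * (e / (L + 1)))).
    by apply: norm_shiftp => l le_l; apply/ltW/hk0; rewrite (leq_trans le0).
  by rewrite mulrA ltr_pdivrMr; nra.
(* [Y' / N] is [Y + tau \o j], and [p] is what remains when [t] is replaced by [tau]. *)
pose Y' k : int := N%:Z * Y k + z (j k).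
pose p k : R := t (j k) - ratr (tau (j k)).
have Y'E k : (Y' k)%:~R / N%:R = (Y k)%:~R + ratr (tau (j k)) :> R.
  have NR : (N%:R : R) != 0 by rewrite pnatr_eq0 -lt0n.
  apply: (mulIf NR); rewrite divfK // /Y' intrD intrM mulrDl mulrC; congr (_ + _).
  by rewrite -(ratr_int R) -zE rmorphM /= ratr_nat mulrC.
have tauE k : (maxn k0 k1 <= k)%N ->
    shiftp (int_poly rat P) (tau \o j) k = - (shiftp P Y k)%:~R.
  move=> /YwE /eqP; rewrite addrC addr_eq0 => /eqP wg.
  rewrite -rmorphN /= -(tauP (g k)) -/(w _) ?wg ?rmorphN //.
  rewrite (@shiftp_wide _ _ _ d) ?size_poly //; apply: eq_bigr => i _.
  by rewrite ffunE coef_map.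
have PY' : kills P Y'.
  exists (maxn k0 k1) => k le_k; apply: (@intr_inj rat); rewrite rmorph0.
  rewrite -[LHS](@shiftp_map _ _ (intr : {rmorphism int -> rat})).
  rewrite (@eq_shiftp _ _ _ (fun k => N%:R * ((Y k)%:~R + tau (j k)))); last first.
    by move=> l _; rewrite /= /Y' intrD intrM mulrDr zE.
  rewrite shiftpZr shiftpDr -/(int_poly rat P) [X in _ + X]tauE //.
  by rewrite (@shiftp_map _ _ (intr : {rmorphism int -> rat}) P Y) subrr mulr0.
have Pp k : (maxn k0 k1 <= k)%N -> shiftp (int_poly R P) p k = 0.
  move=> le_k; rewrite /p shiftpBr wE.
  have -> : shiftp (int_poly R P) (fun k => ratr (tau (j k))) k = ratr (shiftp (int_poly rat P) (tau \o j) k) :> R.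
    by rewrite -(@shiftp_map _ _ (ratr : {rmorphism rat -> R})) map_int_poly.
  by rewrite tauE // rmorphN /= ratr_int opprK addrC YwE.
have PR0 : int_poly R P != 0 by rewrite int_poly_eq0.
(* [p] has finitely many values and satisfies a recurrence, so each window determines the next
   term. *)
have [|k l le_k le_l e'|M M0 pM] := @window_forward_periodic _ [seq t i - ratr (tau i) | i <- enum 'I_m] p (size (int_poly R P)).-1 (maxn k0 k1).
- by move=> k _; apply/mapP; exists (j k); rewrite ?mem_enum.
- rewrite !(shiftp_lead PR0) ?Pp //; apply: eq_bigr => i _.
  by rewrite e'.
exists Y', N, p, M, (\sum_i `|t i - ratr (tau i)|); split=> //.
  by move=> k; rewrite /p (bigD1 (j k)) //= lerDl sumr_ge0.
move=> e' /near[k2 hk2]; exists k2 => k /hk2.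
by rewrite Y'E /p (_ : x k - _ - _ = x k - ((Y k)%:~R + t (j k))) //; ring.
Qed.

End FinitelyManyLimitValues.

(** * Small distances to the integers *)

Section NearestIntegers.
Variables (R : realType) (P : {poly int}) (x : nat -> R).
Hypothesis Px : kills (int_poly R P) x.

Lemma small_dist_int_approximation :
  (limn_esup (fun k => (dist_int (x k))%:E) < ((plength (int_poly R P))^-1)%:E)%E ->
  exists Y : nat -> int, kills P Y /\
    exists c k0, forall k, (k0 <= k)%N -> `|x k - (Y k)%:~R / 1%:R| <= c.
Proof.
move=> /limn_esup_lt[r rL [k0 hr]].
have /choice[Y hY] : forall k, exists m : int, (k0 <= k)%N -> `|x k - m%:~R| < r.
  move=> k; have [/hr/dist_int_lt[m hm]|_] := leqP k0 k; first by exists m.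
  by exists 0.
have [k1 hk1] := Px.
exists Y; split; last first.
  by exists r, k0 => k /hY h; rewrite divr1 ltW.
exists (maxn k0 k1) => k; rewrite geq_max => /andP[le0 le1].
apply: (@int_norm_lt1 R); rewrite -shiftp_int_poly.
rewrite -normrN -sub0r -(hk1 k le1) -shiftpBr.
have r0 : 0 < r by apply: le_lt_trans (hY k le0); apply: normr_ge0.
(* The length is positive because its inverse exceeds [r > 0]. *)
have L0 : 0 < plength (int_poly R P) by rewrite -invr_gt0 (lt_trans r0).
apply: (@le_lt_trans _ _ (plength (int_poly R P) * r)).
  by apply: norm_shiftp => l le_l; apply/ltW/hY; rewrite (leq_trans le0).
by rewrite mulrC -ltr_pdivlMr // div1r.
Qed.

End NearestIntegers.

(** * Short intervals *)

Section ShortIntervals.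
Variable R : realType.

Lemma shiftp_sub_shift (K : comNzRingType) (D : {poly K}) u k l :
  shiftp D u k - shiftp D u l = \sum_(i < size D) D`_i * (u (k + i)%N - u (l + i)%N).
Proof. by rewrite -sumrB; apply: eq_bigr => i _; rewrite mulrBr. Qed.

Lemma norm_shiftp_sub (D : {poly R}) u k l (b : R) :
  (forall i, `|u (k + i)%N - u (l + i)%N| <= b) ->
  `|shiftp D u k - shiftp D u l| <= plength D * b.
Proof.
move=> ub; rewrite shiftp_sub_shift.
apply: le_trans (ler_norm_sum _ _ _) _; rewrite /plength mulr_suml.
by apply: ler_sum => i _; rewrite normrM ler_wpM2l // ub.
Qed.

(** Integers of absolute value at most [b] are coded by naturals below [2b + 1]; [0 + _] is the form
    given by [mem_iota]. *)
Lemma absz_shift (a : int) (b : nat) : (`|a| <= b)%N -> (`|(a + b%:Z)%R| < 0 + (b + b).+1)%N.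
Proof. by rewrite add0n; lia. Qed.

Lemma absz_shiftK (a : int) (b : nat) : (`|a| <= b)%N -> a = `|(a + b%:Z)%R|%N%:Z - b%:Z.
Proof. by lia. Qed.

(* Agreement of [v] on a window lets the leading (resp. constant)
   coefficient [1] of [T] isolate the next (resp. previous) difference of
   values, an integer of absolute value less than [1]. *)
Lemma bounded_int_ev_periodic (T : {poly R}) (v : nat -> int) (b N k0 : nat) :
  T \is monic \/ T`_0 = 1 -> (0 < N)%N ->
  (forall k, (k0 <= k)%N -> (`|v k| <= b)%N) ->
  (forall k l, (k0 <= k)%N -> (k0 <= l)%N -> k = l %[mod N] ->
     `|shiftp T (fun k => (v k)%:~R) k - shiftp T (fun k => (v k)%:~R) l| < 1) ->
  exists2 p, (0 < p)%N & ev_periodic v p.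
Proof.
move=> T1 N0 vb close.
have T0 : T != 0.
  by case: T1 => [/monic_neq0//|]; apply: contra_eqN => /eqP->; rewrite coef0 eq_sym oner_eq0.
(* The residue belongs to the state because [close] compares congruent indices only. *)
pose u k := (v k, k %% N)%N.
pose s := [seq (i%:Z - b%:Z, j) | i <- iota 0 (b + b).+1, j <- iota 0 N].
have us k : (k0 <= k)%N -> u k \in s.
  move=> /vb le_b; apply/allpairsP; exists (`|(v k + b%:Z)%R|%N, (k %% N)%N).
  split; first by rewrite mem_iota absz_shift.
    by rewrite mem_iota ltn_mod.
  by rewrite /u {1}(absz_shiftK le_b).
have size_T : size T = (size T).-1.+1 by rewrite prednK // size_poly_gt0.
have sumE k l : shiftp T (fun k => (v k)%:~R) k - shiftp T (fun k => (v k)%:~R) l =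
    \sum_(i < (size T).-1.+1) T`_i * (v (k + i)%N - v (l + i)%N)%:~R.
  by rewrite shiftp_sub_shift size_T; apply: eq_bigr => i _; rewrite intrB.
have uE k l i : (forall i, (i < size T)%N -> u (k + i)%N = u (l + i)%N) ->
    (i < (size T).-1)%N -> v (k + i)%N = v (l + i)%N.
  by move=> e lt_i; have [] := e i (leq_trans lt_i (leq_pred _)).
have u0 k l : (forall i, (i < size T)%N -> u (k + i)%N = u (l + i)%N) -> k = l %[mod N].
  by move=> e; have := e 0; rewrite size_T !addn0 => /(_ isT)[].
suff [p p0 [k1 up]] : exists2 p, (0 < p)%N & ev_periodic u p.
  by exists p => //; exists k1 => k /up[].
case: T1 => [Tmonic|T00].
  (* A window of [size T] terms is nonempty even for constant [T], so it carries the residue. The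
     relation is then used at [k.+1], where only the last term is unknown. *)
  apply: (window_forward_periodic us (d := size T)) => k l le_k le_l e.
  have kl := u0 _ _ e.
  rewrite /u; congr (_, _); last by apply/eqP; rewrite eqn_modDr; apply/eqP.
  have kl1 : k.+1 = l.+1 %[mod N] by apply/eqP; rewrite -(addn1 k) -(addn1 l) eqn_modDr; apply/eqP.
  have := close k.+1 l.+1 (leqW le_k) (leqW le_l) kl1.
  rewrite sumE big_ord_recr /= big1 ?add0r; last first.
    move=> i _; rewrite !addSnnS.
    have lt_i : (i.+1 < size T)%N by rewrite -ltn_predRL.
    by have [-> _] := e i.+1 lt_i; rewrite subrr mulr0.
  have -> : T`_(size T).-1 = 1 by move/monicP: Tmonic; rewrite lead_coefE.
  rewrite mul1r => /int_norm_lt1/eqP; rewrite subr_eq0 !addSnnS -size_T => /eqP.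
  exact.
apply: (window_backward_periodic us (d := size T)) => k l le_k le_l e.
have kl : k = l %[mod N] by apply/eqP; rewrite -(eqn_modDr 1) !addn1; apply/eqP; apply: u0.
rewrite /u; congr (_, _) => //.
have := close k l le_k le_l kl.
rewrite sumE big_ord_recl /= big1 ?addr0; last first.
  move=> i _; rewrite /bump /= add1n -!addSnnS.
  by rewrite (uE _ _ _ e) // subrr mulr0.
by rewrite T00 mul1r !addn0 => /int_norm_lt1/eqP; rewrite subr_eq0 => /eqP.
Qed.

Section Contradiction.
Variables (P : {poly int}) (x : nat -> R) (M : nat).
Hypothesis P0 : P != 0.
Hypothesis Px : kills (int_poly R P) x.
Hypothesis M0 : (0 < M)%N.

Lemma overreduced_length_lt (l : R) : overreduced_length R P < l ->
  exists (Q S : {poly int}) (T : {poly R}),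
    [/\ P = Q * S, admissible_factor R Q, T \is monic \/ T`_0 = 1 &
        plength (int_poly R S * T) < l].
Proof.
(* The side goal is nonemptiness: [Q = 1] has no root, so it is admissible. *)
move=> /inf_lt[|_ [S [Q PE admQ] <-]].
  exists (reduced_length (int_poly R P)); exists P => //; exists 1; first by rewrite mul1r.
  by move=> z; rewrite /int_poly rmorph1 (negPf (root1 z)).
move=> /inf_lt[|_ [T hT <-] lt_l]; last by exists Q, S, T.
exists (plength (int_poly R S * 1)); exists 1 => //; left; exact: monic1.
Qed.

Lemma short_interval_approximation (l : R) :
  (forall i : nat, in_short_interval l
     (limit_values (fun k => circle_proj (x (k * M + i)%N)))) ->
  exists (eta c : R) (Y : nat -> int) (k0 : nat),
    [/\ 0 < eta, eta < l,
        forall k, (k0 <= k)%N -> `|x k - (Y k)%:~R| <= c &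
        forall k j, (k0 <= k)%N -> (k0 <= j)%N -> k = j %[mod M] ->
          `|(x k - (Y k)%:~R) - (x j - (Y j)%:~R)| < eta].
Proof.
move=> short.
have l0 : 0 < l.
  by have [I [mI _]] := short 0; rewrite -lte_fin; apply: le_lt_trans mI; apply: measure_ge0.
have /choice[ab abP] : forall i : 'I_M, exists ab : R * R, ab.2 - ab.1 < l /\
    limit_values (fun k => circle_proj (x (k * M + i)%N)) `<=`
    @circle_proj R @` [set t | ab.1 <= t <= ab.2].
  by move=> i; have [a [b h]] := in_short_interval_segment (short i); exists (a, b).
have [e e0 he] : exists2 e : R, 0 < e & forall i, e <= l - ((ab i).2 - (ab i).1).
  by apply: finite_pos_bound => i; have [] := abP i; lra.
(* [eta] exceeds every segment length, which leaves room for open intervals, and the minimum with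
   [l] keeps it positive. *)
pose eta := l - Num.min e l / 2.
have min0 : 0 < Num.min e l by rewrite lt_min e0 l0.
have [mine minl] : Num.min e l <= e /\ Num.min e l <= l by rewrite !ge_min !lexx orbT.
have eta0 : 0 < eta by rewrite /eta; lra.
pose V (i : 'I_M) : set R := [set t | `|t - ((ab i).1 + (ab i).2) / 2| < eta / 2].
have /choice[k1 hk1] : forall i : 'I_M, exists k1, forall k, (k1 <= k)%N ->
    exists m : int, V i (x (k * M + i)%N - m%:~R).
  move=> i; apply: (@limit_values_sub_open _ (fun k => x (k * M + i)%N)).
    rewrite (_ : V i = ball (((ab i).1 + (ab i).2) / 2) (eta / 2)); first exact: ball_open.
    by apply/seteqP; split=> t; rewrite /ball /V /= distrC.
  have [_ sub] := abP i; apply: (subset_trans sub); apply: image_subset => t /= /andP[h1 h2].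
  rewrite /V /= ltr_norml /eta; have := he i; lra.
pose res k := Ordinal (ltn_pmod k M0).
(* The sum exceeds each threshold; the factor [M] converts bounds on [k %/ M] into bounds on [k]. *)
pose k0 := ((\sum_i k1 i) * M)%N.
have /choice[Y hY] : forall k, exists m : int, (k0 <= k)%N -> V (res k) (x k - m%:~R).
  move=> k; have [le_k|_] := leqP k0 k; last by exists 0.
  have [|m hm] := hk1 (res k) (k %/ M)%N; last by exists m => _; move: hm; rewrite /= -divn_eq.
  rewrite leq_divRL //; apply: leq_trans le_k; rewrite leq_mul2r.
  by rewrite (bigD1 (res k)) //= leq_addr orbT.
exists eta, (\sum_i `|((ab i).1 + (ab i).2) / 2| + eta / 2), Y, k0; split=> //.
- by rewrite /eta; lra.
- move=> k /hY; rewrite /V /= => h.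
  have : `|((ab (res k)).1 + (ab (res k)).2) / 2| <= \sum_i `|((ab i).1 + (ab i).2) / 2|.
    by rewrite (bigD1 (res k)) //= lerDl sumr_ge0.
  set C := ((ab (res k)).1 + (ab (res k)).2) / 2 in h *.
  have := ler_normD (x k - (Y k)%:~R - C) C; rewrite subrK; lra.
- move=> k j /hY hk /hY hj kj.
  have e1 : res j = res k by apply: val_inj.
  move: hk hj; rewrite e1 /V /= !ltr_norml => /andP[h1 h2] /andP[h3 h4].
  by apply/andP; split; lra.
Qed.

Lemma short_intervals_recurrence :
  (forall i : nat, in_short_interval (overreduced_length R P)^-1
     (limit_values (fun k => circle_proj (x (k * M + i)%N)))) ->
  exists (Y : nat -> int) (B : {poly int}), [/\ B != 0, kills B Y &
    exists c k0, forall k, (k0 <= k)%N -> `|x k - (Y k)%:~R / 1%:R| <= c].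
Proof.
move=> /short_interval_approximation[eta [c [Y [k0 [eta0 lt_eta zc zeta]]]]].
have lam0 : 0 < overreduced_length R P by rewrite -invr_gt0 (lt_trans eta0).
(* Since [eta] is below the inverse of the overreduced length, the latter is below [eta^-1]. *)
have [|Q [S [T [PE admQ T1 lt_ST]]]] := @overreduced_length_lt eta^-1.
  by rewrite -[ltLHS]invrK ltf_pV2 // posrE invr_gt0.
have lt1 : plength (int_poly R S * T) * eta < 1.
  by rewrite -ltr_pdivlMr // div1r.
have [Q0 S0] : Q != 0 /\ S != 0.
  by apply/andP; rewrite -negb_or -mulf_eq0 -PE.
pose SR := int_poly R S; pose w := shiftp SR x.
pose z k := x k - (Y k)%:~R.
pose v := shiftp S Y.
have vE k : (v k)%:~R = w k - shiftp SR z k.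
  rewrite -shiftpBr /v -shiftp_int_poly; apply: eq_shiftp => j _.
  by rewrite /z opprB addrC subrK.
have Qw : kills (int_poly R[i] Q) (fun k => (w k)%:C%C).
  rewrite -(map_int_poly (real_complex R)).
  apply: (@kills_map _ _ (real_complex R)); rewrite -kills_shiftp.
  by rewrite /int_poly -rmorphM -PE.
(* [w = S x] is killed by the admissible [Q], so it nearly repeats modulo some [K]. *)
have [K K0 /(asymp_periodic_cauchy K0) cauchy] := admissible_asymp_periodic Q0 admQ Qw.
have wcauchy (e : R) : 0 < e -> exists k1, forall k l, (k1 <= k)%N -> (k1 <= l)%N ->
    k = l %[mod K] -> `|w k - w l| < e.
  move=> /cauchy[k1 h]; exists k1 => k l le_k le_l kl.
  by have := h k l le_k le_l kl; rewrite -rmorphB normc_real.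
have [k1 wb] : exists k1, exists c', forall k, (k1 <= k)%N -> `|w k| <= c'.
  have [k1 h] := wcauchy 1 ltr01; exists k1, (\sum_(j < K) `|w (k1 + j)%N| + 1) => k le_k.
  pose j := Ordinal (ltn_pmod (k - k1) K0).
  have := h k (k1 + j)%N le_k (leq_addr _ _).
  rewrite /= modnDmr subnKC // => /(_ erefl) h1.
  have h2 : `|w (k1 + j)%N| <= \sum_(j < K) `|w (k1 + j)%N|.
    by rewrite (bigD1 j) //= lerDl sumr_ge0.
  have := ler_normD (w k - w (k1 + j)%N) (w (k1 + j)%N); rewrite subrK /= => h3.
  by apply: (le_trans h3); rewrite addrC lerD // ltW.
have [c' wc'] := wb.
pose LT := plength T.
have LT0 : 0 <= LT by apply: plength_ge0.
pose e := 1 - plength (SR * T) * eta.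
have e0 : 0 < e by rewrite /e; lra.
have [k2 hk2] : exists k2, forall k l, (k2 <= k)%N -> (k2 <= l)%N ->
    k = l %[mod K] -> `|w k - w l| < e / (LT + 1).
  by apply: wcauchy; apply: divr_gt0 => //; lra.
pose k3 := maxn k0 (maxn k1 k2).
pose b := Num.bound (c' + plength SR * c).
have modD k l N N' i : k = l %[mod N * N'] -> (k + i = l + i %[mod N])%N.
  move=> kl; apply/eqP; rewrite eqn_modDr.
  by rewrite -(@modn_dvdm (N * N') k N) ?dvdn_mulr // kl modn_dvdm ?dvdn_mulr.
have [|||p p0 [k4 vp]] := @bounded_int_ev_periodic T v b (K * M) k3 T1.
- by rewrite muln_gt0 K0.
- move=> k; rewrite !geq_max => /and3P[le0 le1 le2].
  have hv : `|(v k)%:~R : R| <= c' + plength SR * c.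
    rewrite vE; apply: le_trans (ler_normB _ _) _; rewrite lerD ?wc' //.
    by apply: norm_shiftp => j le_j; apply: zc; rewrite (leq_trans le0).
  have : `|(v k)%:~R : R| < b%:R.
    apply: (le_lt_trans hv); apply: archi_boundP; exact: le_trans hv.
  by rewrite -intr_norm -abszE -pmulrn ltr_nat => /ltnW.
- move=> k l; rewrite !geq_max => /and3P[k_0 k_1 k_2] /and3P[l_0 l_1 l_2] kl.
  (* The [w] term varies by less than the slack [e] along indices congruent modulo [K], the [z] term
     by at most [1 - e] along those congruent modulo [M]. *)
  have Tv j : shiftp T (fun k => (v k)%:~R) j = shiftp T w j - shiftp (SR * T) z j.
    rewrite mulrC shiftpM -shiftpBr; apply: eq_shiftp => i _; exact: vE.
  rewrite !Tv.
  have h1 : `|shiftp T w k - shiftp T w l| <= LT * (e / (LT + 1)).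
    apply: norm_shiftp_sub => i; apply/ltW/hk2; last exact: (modD _ _ _ _ _ kl).
      by rewrite (leq_trans k_2) ?leq_addr.
    by rewrite (leq_trans l_2) ?leq_addr.
  have h2 : `|shiftp (SR * T) z k - shiftp (SR * T) z l| <= plength (SR * T) * eta.
    apply: norm_shiftp_sub => i; apply/ltW/zeta; last by apply: (modD _ _ M K); rewrite mulnC.
      by rewrite (leq_trans k_0) ?leq_addr.
    by rewrite (leq_trans l_0) ?leq_addr.
  have h3 : LT * (e / (LT + 1)) < e by rewrite mulrA ltr_pdivrMr; nra.
  rewrite (_ : _ - _ = (shiftp T w k - shiftp T w l) - (shiftp (SR * T) z k - shiftp (SR * T) z l)); last by ring.
  by apply: le_lt_trans (ler_normB _ _) _; move: h3; rewrite {2}/e; lra.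
(* [S] maps [Y] to the eventually [p]-periodic sequence [v], which ['X^p - 1] kills. *)
exists Y, (('X^p - 1) * S); split.
- rewrite mulf_neq0 // -size_poly_gt0 -polyC1 size_XnsubC //.
- exists k4 => k /vp; rewrite shiftpM shiftpB shiftpXn (@shiftpC _ 1) mul1r => /eqP.
  by rewrite -subr_eq0 => /eqP.
- by exists c, k0 => k /zc; rewrite divr1.
Qed.

End Contradiction.

End ShortIntervals.

Theorem theorem1p3 (R : realType) (P : {poly int}) (x : nat -> R)
    (n : nat) (alpha : 'I_n -> R[i]) (F : 'I_n -> {poly R[i]}) :
  P != 0 ->
  (forall k : nat, (1 <= k)%N ->
     \sum_(i < size P) (P`_i)%:~R * x (k + i)%N = 0) ->
  injective alpha ->
  (forall k : nat, (1 <= k)%N ->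
     (x k)%:C%C = \sum_(i < n) (F i).[k%:R] * alpha i ^+ k) ->
  (cond_a alpha F \/ cond_b alpha F \/ cond_c alpha F \/ cond_d alpha F ->
     [/\ infinite_set (limit_values (fun k => circle_proj (x k))),
         (((plength (int_poly R P))^-1)%:E
            <= limn_esup (fun k => (dist_int (x k))%:E))%E
       & forall M : nat, (1 <= M)%N -> exists l : nat,
           ~ in_short_interval (overreduced_length R P)^-1
               (limit_values (fun k => circle_proj (x (k * M + l)%N)))])
  /\
  (cond_e alpha F -> infinite_set (limit_values (fun k => circle_proj (x k)))).
Proof.
move=> P0 recP inj_alpha xE.
have Px : kills (int_poly R P) x.
  exists 1%N => k /recP <-; rewrite (@shiftp_wide _ _ _ (size P)) ?size_poly //.
  by apply: eq_bigr => i _; rewrite coef_map.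
split=> [cond|cond_e finE].
  split.
  - move=> /(finite_limit_values_approximation P0 Px)[Y [N [p [m [c [PY _ _ pc near]]]]]].
    have [k0 h] := near 1 ltr01.
    (* The periodic part is bounded by [c] and the error by [1]; [P] itself is the recurrence of
       [Y]. *)
    apply: (bounded_approximation P0 Px inj_alpha xE P0 PY (N := N) (c := c + 1) (k0 := k0)) cond.
    move=> k /h hk; have := ler_normD (x k - (Y k)%:~R / N%:R - p k) (p k).
    by rewrite subrK; have := pc k; lra.
  - rewrite leNgt; apply/negP => /(small_dist_int_approximation Px)[Y [PY [c [k0 h]]]].
    exact: (bounded_approximation P0 Px inj_alpha xE P0 PY h).
  - move=> M M0; apply: contrapT => /forallNP short.
    have [|Y [B [B0 BY [c [k0 h]]]]] := @short_intervals_recurrence _ _ x M P0 Px M0.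
      by move=> l; apply: contrapT; apply: short.
    exact: (bounded_approximation P0 Px inj_alpha xE B0 BY h).
have [Y [N [p [m [c [PY m0 pm _ near]]]]]] := finite_limit_values_approximation P0 Px finE.
exact: (asymp_periodic_approximation P0 Px inj_alpha xE P0 PY m0 pm near).
Qed.
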